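(* Let $c\ge 93$ be an integer, let $\alpha\ge 1$ be an integer, and let $T$ be an $r$-regular $c$-partite tournament in which every partite set has cardinality $\alpha$. Then $T$ is $4$-arc-pancyclic; that is, every arc of $T$ belongs to a directed cycle of length $\ell$ for every integer $\ell$ with $4\le \ell\le c\alpha$.
   Context: A $c$-partite tournament is an orientation of a complete $c$-partite graph (finite, with $c$ nonempty partite sets): between any two vertices in different partite sets there is exactly one arc, and there are no arcs within a partite set. A digraph is $r$-regular if $d^+(v)=d^-(v)=r$ for every vertex $v$. For an $r$-regular $c$-partite tournament with partite sets of cardinality $\alpha$ one has $r=(c-1)\alpha/2$ and $|V(T)|=c\alpha$. Cycles are directed and simple; the length of a cycle is its number of arcs. A digraph $D$ is $k$-arc-pancyclic if every arc of $D$ belongs to a cycle of length $\ell$ for every integer $\ell$ with $k\le\ell\le|V(D)|$. *)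

(* Defs.v *)
From mathcomp Require Import all_boot.

Set Implicit Arguments.
Unset Strict Implicit.
Unset Printing Implicit Defensive.

(* A digraph on the vertex set V is given by its arc relation [e]; [P] is the
   set of partite sets.  [partition] makes the partite sets nonempty, pairwise
   disjoint and covering; the exclusive or [(+)] says that exactly one of
   (u, v) and (v, u) is an arc. *)
Definition multipartite_tournament (c : nat) (V : finType)
    (P : {set {set V}}) (e : rel V) : Prop :=
  [/\ partition P [set: V],
      #|P| = c,
      forall u v : V, pblock P u = pblock P v -> ~~ e u v &
      forall u v : V, pblock P u <> pblock P v -> e u v (+) e v u].

Definition outdeg (V : finType) (e : rel V) (v : V) : nat :=
  #|[set w | e v w]|.

Definition indeg (V : finType) (e : rel V) (v : V) : nat :=
  #|[set w | e w v]|.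

Definition regular_digraph (r : nat) (V : finType) (e : rel V) : Prop :=
  forall v : V, outdeg e v = r /\ indeg e v = r.

(* A directed simple cycle is the duplicate-free cyclic sequence of its
   vertices, so its number of arcs is its size.  Its arcs are the pairs
   (x, next s x) with x in s. *)
Definition arc_in_cycle_of_length (V : finType) (e : rel V) (u v : V)
    (l : nat) : Prop :=
  exists s : seq V, [/\ ucycle e s, size s = l, u \in s & next s u = v].

Definition arc_pancyclic (k : nat) (V : finType) (e : rel V) : Prop :=
  forall u v : V, e u v ->
  forall l : nat, k <= l <= #|V| -> arc_in_cycle_of_length e u v l.

(* Main.v *)
Require Import Defs.
From mathcomp Require Import all_boot all_fingroup zify.

Set Implicit Arguments.
Unset Strict Implicit.
Unset Printing Implicit Defensive.

(** Closing a path with the arc from u to v, it suffices to find, for all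
    4 <= l <= |V|, a path from v to u on exactly l vertices.  With all classes
    of size a and all degrees r, the order is 2r + a, so that having at least
    93 classes means 46 a <= r.  Two counting arguments drive the proof.  If no
    arc leads from a nonempty set A to a set B, then |A| + 2|B| < 2r + 4a
    ([no_arc_bound]); and, by averaging, outside any small set there is a vertex
    dominating roughly half of any prescribed set ([pivot_step]).

    Short paths.  By the first argument, two vertices of a set X of at most r/2
    vertices are joined by a path whose four inner vertices avoid X ([link4]).
    A greedy path from v completed by such a link to u gives every length l
    with 2(l - 4) <= r ([short_paths]).

    Insertion.  A vertex f can be inserted into a path having a gap for f, that
    is, consecutive vertices p, q with arcs p -> f -> q.  A path has a gap for f
    as soon as an in-neighbour of f precedes an out-neighbour of f on it and no
    vertex in between belongs to the class of f ([gap_between]).  Gaps survive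
    the insertion of vertices of other classes, so that vertices of pairwise
    distinct classes can all be inserted ([gap_insert_all]).

    Singleton classes.  The averaging argument, iterated, gives a family Q of 6
    and a family S of 7 vertices such that all but very few vertices have an
    in-neighbour in v, Q and an out-neighbour in S, u.  Joining v, Q, S, the
    exceptional vertices and u in this order by links yields a path with at most
    4 + r/2 vertices that has a gap for every other vertex.  Inserting any
    number of them gives all the remaining lengths ([singleton_paths]).

    Larger classes.  Vertices sharing a class obstruct mass insertion, and the
    bulk of the path comes from another source: deleting a moderate set leaves
    a digraph with a cycle factor ([cycle_factor]), by an augmentation argument,
    and a path and a cycle of a multipartite tournament can be merged into a
    single path ([path_cycle_merge]), so that a Hamiltonian path remains
    ([ham_path_avoiding]).  Delete a path from v that ends with a family Q of 8
    vertices, and a path to u that starts with a family S of 9 vertices, such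
    that every vertex left has an in-neighbour in Q and an out-neighbour in S
    ([skeleton]).  An initial segment of the Hamiltonian path, of any length,
    is attached to an in-neighbour in Q of its first vertex and to an
    out-neighbour in S of its last vertex.  The vertices of Q and S bypassed in
    this way have pairwise distinct classes, and the deleted path from v has
    been prepared with a block containing a gap for each of them, where they are
    inserted back.  Every length beyond the size of the skeleton is obtained
    ([long_paths]), and the skeleton has at most 4 + r/2 vertices. *)

(** * Regular multipartite tournaments and arc counting *)

(** The classes are the fibres of [K] instead of the blocks of a partition:
    two vertices are adjacent exactly when their images differ. *)
Record regular_mpt (V : finType) (T : eqType) (K : V -> T) (e : rel V)
    (a r : nat) : Prop := RegularMpt {
  mpt_same : forall x y, K x = K y -> ~~ e x y;
  mpt_adj : forall x y, K x != K y -> e x y (+) e y x;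
  mpt_class : forall x, #|[set y | K y == K x]| = a;
  mpt_out : forall x, #|[set y | e x y]| = r;
  mpt_in : forall x, #|[set y | e y x]| = r;
  mpt_many_classes : 93 * a <= #|V| }.

Definition converse (V : Type) (e : rel V) : rel V := fun x y => e y x.

Lemma converse_mpt (V : finType) (T : eqType) (K : V -> T) (e : rel V)
    (a r : nat) :
  regular_mpt K e a r -> regular_mpt K (converse e) a r.
Proof.
case=> h1 h2 h3 h4 h5 h6; split=> //.
- by move=> x y eK; apply: h1.
- by move=> x y nK; rewrite addbC; apply: h2.
Qed.

Lemma sum_card_rel (V : finType) (e : rel V) (A B : {set V}) :
  \sum_(x in A) #|[set y in B | e x y]| = \sum_(y in B) #|[set x in A | e x y]|.
Proof.
transitivity (\sum_(x in A) \sum_(y in B) (e x y : nat)).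
  apply: eq_bigr => x _; rewrite -sum1dep_card big_mkcondr.
  by apply: eq_bigr => y _; case: (e x y).
rewrite exchange_big; apply: eq_bigr => y _.
rewrite -sum1dep_card big_mkcondr.
by apply: eq_bigr => x _; case: (e x y).
Qed.

Lemma sum_bound (V : finType) (A : {set V}) (f : V -> nat) m :
  (forall x, x \in A -> f x <= m) -> \sum_(x in A) f x <= #|A| * m.
Proof.
by move=> h; rewrite -sum_nat_const; apply: leq_sum => x xA; apply: h.
Qed.

Lemma sum_lbound (V : finType) (A : {set V}) (f : V -> nat) m :
  (forall x, x \in A -> m <= f x) -> #|A| * m <= \sum_(x in A) f x.
Proof.
by move=> h; rewrite -sum_nat_const; apply: leq_sum => x xA; apply: h.
Qed.

Section Counting.
Variables (V : finType) (T : eqType) (K : V -> T) (e : rel V) (a r : nat).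
Hypothesis H : regular_mpt K e a r.

Lemma mpt_asym x y : e x y -> ~~ e y x.
Proof.
move=> exy; have nK : K x != K y.
  by apply/eqP => /(mpt_same H); rewrite exy.
by have := mpt_adj H nK; rewrite exy.
Qed.

Lemma mpt_irr x : ~~ e x x.
Proof. exact: (mpt_same H). Qed.

Lemma mpt_arc_class x y : e x y -> K x != K y.
Proof. by move=> exy; apply/eqP => /(mpt_same H); rewrite exy. Qed.

Lemma mpt_arc_neq x y : e x y -> x != y.
Proof. by move=> exy; apply: contraTneq exy => ->; apply: mpt_irr. Qed.

Lemma mpt_rev x y : K x != K y -> ~~ e x y -> e y x.
Proof. by move=> /(mpt_adj H); case: (e x y). Qed.

Lemma card_nonout x : #|[set y | ~~ e x y]| = #|V| - r.
Proof.
rewrite -(mpt_out H x) -(cardsC [set y | e x y]) addKn.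
by apply: eq_card => y; rewrite !inE.
Qed.

Lemma card_nonin x : #|[set y | ~~ e y x]| = #|V| - r.
Proof.
rewrite -(mpt_in H x) -(cardsC [set y | e y x]) addKn.
by apply: eq_card => y; rewrite !inE.
Qed.

Lemma order_mpt (x : V) : #|V| = 2 * r + a.
Proof.
rewrite -cardsT; have -> : [set: V] =
   ([set y | e x y] :|: [set y | e y x]) :|: [set y | K y == K x].
  apply/setP => y; rewrite !inE; case: eqVneq => [_|nK]; first by rewrite orbT.
  by have := mpt_adj H nK; case: (e y x); case: (e x y).
rewrite !cardsU (mpt_out H) (mpt_in H) (mpt_class H).
have -> : [set y | e x y] :&: [set y | e y x] = set0.
  apply/setP => y; rewrite !inE; apply/negP => /andP[/mpt_asym exy].
  by rewrite (negbTE exy).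
have -> : ([set y | e x y] :|: [set y | e y x]) :&: [set y | K y == K x] = set0.
  apply/setP => y; rewrite !inE; apply/negP => /andP[/orP[]/mpt_arc_class nK].
    by rewrite eq_sym (negbTE nK).
  by rewrite (negbTE nK).
by rewrite cards0; lia.
Qed.

(** The order is 2r + a and contains 93 classes. *)
Lemma mpt_dense : 46 * a <= r.
Proof.
have := mpt_many_classes H; have [x _|/eq_card0 ->] := pickP V; last by clear; lia.
by rewrite (order_mpt x); clear; lia.
Qed.

Lemma class_gt0 (x : V) : 0 < a.
Proof. by rewrite -(mpt_class H x) card_gt0; apply/set0Pn; exists x; rewrite inE. Qed.

(** Each pair of vertices of [A] carries at most one arc. *)
Lemma inner_arcs (A : {set V}) :
  2 * (\sum_(x in A) #|[set y in A | e x y]|) + #|A| <= #|A| * #|A|.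
Proof.
rewrite mul2n -addnn {2}sum_card_rel -big_split /=.
rewrite -{1}(muln1 #|A|) -sum_nat_const -big_split /=.
apply: sum_bound => x xA.
rewrite -cardsUI [X in _ + X + _](_ : _ = 0) ?addn0; last first.
  apply: eq_card0 => y; rewrite !inE; apply/negP => /andP[/andP[_ exy]].
  by rewrite (negbTE (mpt_asym exy)) andbF.
rewrite -(cards1 x) -cardsUI [X in _ + X](_ : _ = 0) ?addn0; last first.
  apply: eq_card0 => y; rewrite !inE; case: eqP => [->|]; rewrite ?andbF //.
  by rewrite (negbTE (mpt_irr x)) !andbF.
apply: subset_leq_card; apply/subsetP => y; rewrite !inE.
by case: eqP => [->|] //; rewrite orbF => _ /orP[]/andP[].
Qed.

(** Each vertex is adjacent to all vertices but the [a] ones of its class. *)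
Lemma inner_arcs_lower (A : {set V}) :
  #|A| * #|A| <= 2 * (\sum_(x in A) #|[set y in A | e x y]|) + #|A| * a.
Proof.
rewrite mul2n -addnn {2}sum_card_rel -big_split /=.
rewrite -(sum_nat_const (mem A) a) -big_split /=.
apply: sum_lbound => x xA.
apply: (@leq_trans #|([set y in A | e x y] :|: [set y in A | e y x])
     :|: [set y | K y == K x]|).
  apply: subset_leq_card; apply/subsetP => y yA; rewrite !inE yA /=.
  case: eqVneq => [_|nK]; first by rewrite orbT.
  by have := mpt_adj H nK; case: (e y x); case: (e x y).
apply: (leq_trans (leq_card_setU _ _)); rewrite (mpt_class H) leq_add2r.
exact: leq_card_setU.
Qed.

(** Count the |A| r arcs leaving [A].  At most |A|(|A| - 1)/2 of them stay in
    [A], at most s|B| reach [B], and every vertex outside [A] and [B] receives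
    at most |A|.  The overlap of [A] and [B] is small since, inside it, the
    in-degrees are at most [s] while most pairs are adjacent. *)
Lemma few_arcs_bound (s : nat) (A B : {set V}) :
  (forall y, y \in B -> #|[set x in A | e x y]| <= s) ->
  #|A| * #|A| + #|A| + 2 * (#|A| * #|B|) <=
    (2 * r + 4 * a + 4 * s) * #|A| + 2 * (s * #|B|).
Proof.
move=> hB; have [->|/set0Pn[x0 x0A]] := eqVneq A set0; first by rewrite cards0.
have n_eq := order_mpt x0.
have hI : #|A :&: B| <= a + 2 * s.
  have [->|nI] := eqVneq (A :&: B) set0; first by rewrite cards0.
  have := inner_arcs_lower (A :&: B); rewrite sum_card_rel.
  have : \sum_(y in A :&: B) #|[set x in A :&: B | e x y]| <= #|A :&: B| * s.
    apply: sum_bound => y; rewrite inE => /andP[yA yB].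
    apply: leq_trans (hB y yB); apply: subset_leq_card; apply/subsetP => x.
    by rewrite !inE => /andP[/andP[-> _] ->].
  have : 0 < #|A :&: B| by rewrite card_gt0.
  by move: #|_ :&: _| (\sum_(_ in _) _) => i S; nia.
have hU : #|A :|: B| + #|~: (A :|: B)| = 2 * r + a by rewrite cardsC.
have hAB := cardsUI A B.
have h1 : \sum_(x in A) #|[set y in B | e x y]| <= s * #|B|.
  by rewrite sum_card_rel mulnC; apply: sum_bound.
have h2 := inner_arcs A.
have h3 : \sum_(x in A) #|[set y in ~: (A :|: B) | e x y]| <=
    #|A| * #|~: (A :|: B)|.
  apply: sum_bound => x _; apply: subset_leq_card; apply/subsetP => y.
  by rewrite inE => /andP[].
have h4 : #|A| * r <= \sum_(x in A) #|[set y in A | e x y]| +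
   \sum_(x in A) #|[set y in B | e x y]| +
   \sum_(x in A) #|[set y in ~: (A :|: B) | e x y]|.
  rewrite -!big_split /=; apply: sum_lbound => x _.
  rewrite -(mpt_out H x).
  apply: leq_trans (leq_trans (leq_card_setU _ _) (leq_add (leq_card_setU _ _) (leqnn _))).
  apply: subset_leq_card; apply/subsetP => y; rewrite !inE => ->.
  by rewrite !andbT; case: (y \in A); case: (y \in B).
move: h1 h2 h3 h4 hU hAB hI.
move: #|~: _| #|_ :|: _| #|_ :&: _| #|A| #|B| (\sum_(_ in _) _) (\sum_(_ in _) _) (\sum_(_ in _) _).
move=> c u i x y S1 S2 S3 h1 h2 h3 h4 hU hAB hI.
have c_le : c + x + y <= 2 * r + 2 * a + 2 * s by lia.
have := leq_mul (leqnn x) c_le; lia.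
Qed.

Lemma no_arc_bound (A B : {set V}) :
  A != set0 -> {in A & B, forall x y, ~~ e x y} ->
  #|A| + 2 * #|B| + 1 <= 2 * r + 4 * a.
Proof.
rewrite -card_gt0 => A0 hAB.
have h0 : forall y, y \in B -> #|[set x in A | e x y]| <= 0.
  move=> y yB; rewrite leqn0 cards_eq0; apply/eqP/setP => x; rewrite !inE.
  by apply/negP => /andP[xA]; apply/negP; apply: hAB.
have := few_arcs_bound h0; move: A0; move: #|A| #|B| => x y; nia.
Qed.

End Counting.

(** * Links of two or four vertices *)

(** The vertex [x] itself belongs to [X] and is no out-neighbour of [x]. *)
Lemma out_avoid (V : finType) (T : eqType) (K : V -> T) (e : rel V) (a r : nat)
    (X : {set V}) x :
  regular_mpt K e a r -> x \in X ->
  r + 1 <= #|[set y | e x y] :\: X| + #|X|.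
Proof.
move=> H xX; have := cardsID X [set y | e x y]; rewrite (mpt_out H).
have : #|[set y | e x y] :&: X| < #|X|.
  apply: proper_card; apply/properP; split; first exact: subsetIr.
  by exists x => //; rewrite !inE (negbTE (mpt_irr H x)).
lia.
Qed.

Lemma in_avoid (V : finType) (T : eqType) (K : V -> T) (e : rel V) (a r : nat)
    (X : {set V}) x :
  regular_mpt K e a r -> x \in X ->
  r + 1 <= #|[set y | e y x] :\: X| + #|X|.
Proof. by move/converse_mpt; apply: out_avoid. Qed.

Section Links.
Variables (V : finType) (T : eqType) (K : V -> T) (e : rel V) (a r : nat).
Hypothesis H : regular_mpt K e a r.

Lemma large_sets_arc (A B : {set V}) : A != set0 ->
  2 * r + 4 * a < #|A| + 2 * #|B| + 1 ->
  exists p q, [/\ p \in A, q \in B & e p q].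
Proof.
move=> A0 big; have [hno|] := boolP [forall p in A, forall q in B, ~~ e p q].
  have hAB : {in A & B, forall p q, ~~ e p q}.
    by move=> p q pA qB; move/forall_inP/(_ p pA)/forall_inP: hno; apply.
  by have := no_arc_bound H A0 hAB; lia.
rewrite negb_forall_in => /exists_inP[p pA].
rewrite negb_forall_in => /exists_inP[q qB].
by rewrite negbK => epq; exists p, q.
Qed.

Lemma link2 (X : {set V}) x y : #|X| <= 3 -> x \in X -> y \in X ->
  exists l, [/\ size l = 2, uniq l, all (fun z => z \notin X) l
              & path e x (rcons l y)].
Proof.
move=> X3 xX yX; have a0 := class_gt0 H x; have dense := mpt_dense H.
set A := [set z | e x z] :\: X; set B := [set z | e z y] :\: X.
have hA : r + 1 <= #|A| + #|X| := out_avoid H xX.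
have hB : r + 1 <= #|B| + #|X| := in_avoid H yX.
have A0 : A != set0 by rewrite -card_gt0; lia.
have [|p [q []]] := large_sets_arc A0 (B := B); first lia.
rewrite !inE => /andP[pX exp] /andP[qX eqy] epq; exists [:: p; q]; split=> //=.
- by rewrite inE andbT (mpt_arc_neq H epq).
- by rewrite pX qX.
- by rewrite exp epq eqy.
Qed.

(** Let A consist of the out-neighbours of x and B of the in-neighbours of y,
    outside X.  Each has about r/2 vertices at least, which is too few for
    an arc from A to B or a vertex between them.  But the vertices with two
    in-neighbours in A and those with an out-neighbour in B are so many that
    an arc m -> m' leads from the former to the latter.  Then m' -> q for some
    q in B, and the second in-neighbour of m leaves one, p, distinct from q. *)
Lemma link4 (X : {set V}) x y : 2 * #|X| <= r -> x \in X -> y \in X ->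
  exists l, [/\ size l = 4, uniq l, all (fun z => z \notin X) l
              & path e x (rcons l y)].
Proof.
move=> Xr xX yX; have a0 := class_gt0 H x; have dense := mpt_dense H.
have n_eq := order_mpt H x.
set A := [set z | e x z] :\: X; set B := [set z | e z y] :\: X.
have hA : r + 1 <= #|A| + #|X| := out_avoid H xX.
have hB : r + 1 <= #|B| + #|X| := in_avoid H yX.
have hX : #|X| + #|~: X| = 2 * r + a by rewrite cardsC.
pose ndeg z := #|[set p in A | e p z]|; pose odeg z := #|[set q in B | e z q]|.
set M := [set z in ~: X | 1 < ndeg z]; set N := [set z in ~: X | 0 < odeg z].
have hM : #|M| + #|~: X :\: M| = #|~: X|.
  rewrite -(cardsID M (~: X)) (setIidPr _) //.
  by apply/subsetP => z; rewrite inE => /andP[].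
have hN : #|N| + #|~: X :\: N| = #|~: X|.
  rewrite -(cardsID N (~: X)) (setIidPr _) //.
  by apply/subsetP => z; rewrite inE => /andP[].
have bM : #|A| * #|A| + #|A| + 2 * (#|A| * #|~: X :\: M|) <=
    (2 * r + 4 * a + 4) * #|A| + 2 * #|~: X :\: M|.
  have := @few_arcs_bound _ _ _ _ _ _ H 1 A (~: X :\: M); rewrite muln1 mul1n.
  apply=> z; rewrite !inE => /andP[h zX].
  by move: h; rewrite zX /= -leqNgt.
have bN : #|B| + 2 * #|~: X :\: N| + 1 <= 2 * r + 4 * a.
  apply: (no_arc_bound (converse_mpt H)); first by rewrite -card_gt0; lia.
  move=> q z qB; rewrite !inE => /andP[h zX]; move: h.
  rewrite zX /= -leqNgt leqn0 cards_eq0 => /eqP h0.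
  apply/negP; rewrite /converse => ezq; move/setP/(_ q): h0.
  by move: qB; rewrite !inE ezq => ->.
(* by [le4] the last term of [bM] is at most 8|A|, so that |A| can be divided out *)
have bM' : #|A| + 2 * #|~: X :\: M| <= 2 * r + 4 * a + 11.
  have le4 : #|~: X :\: M| <= 4 * #|A|.
    have : #|~: X :\: M| <= #|~: X| by rewrite -hM leq_addl.
    lia.
  have A0 : 0 < #|A| by lia.
  move: bM le4 A0; move: #|_ :\: _| #|A| => u x0 h1 h2 h3; nia.
have [||m [m' [mM m'N emm']]] := @large_sets_arc M N.
- by rewrite -card_gt0; lia.
- lia.
move: mM m'N; rewrite !inE => /andP[mX nM] /andP[m'X].
rewrite card_gt0 => /set0Pn[q]; rewrite !inE => /andP[/andP[qX eqy] em'q].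
have [p pA /andP[epm pq]] : exists2 p, p \in A & e p m && (p != q).
  move: nM; rewrite /ndeg (cardsD1 q) => h.
  have : 0 < #|[set p in A | e p m] :\ q| by move: h; case: (_ \in _) => /=; lia.
  rewrite card_gt0 => /set0Pn[p]; rewrite !inE => /andP[pq /andP[pA epm]].
  by exists p; rewrite ?inE ?pA // epm.
move: pA; rewrite !inE => /andP[pX exp].
exists [:: p; m; m'; q]; split=> //=.
- rewrite !inE !negb_or (mpt_arc_neq H epm) pq (mpt_arc_neq H emm').
  rewrite (mpt_arc_neq H em'q) /= !andbT; apply/andP; split.
    by apply: contraTneq emm' => <-; apply: mpt_asym H _ _ epm.
  by apply: contraTneq em'q => <-; apply: mpt_asym H _ _ emm'.
- by rewrite pX mX m'X qX.
- by rewrite exp epm emm' em'q eqy.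
Qed.
End Links.

(** * Short paths by greedy extension *)

Lemma card_set_seq (V : finType) (s : seq V) : uniq s -> #|[set x in s]| = size s.
Proof. by move=> us; rewrite cardsE; apply/card_uniqP. Qed.

Definition path_of_length (V : finType) (e : rel V) (x y : V) (l : nat) :=
  exists s, [/\ path e x s, last x s = y, uniq (x :: s) & size (x :: s) = l].

Section Short.
Variables (V : finType) (T : eqType) (K : V -> T) (e : rel V) (a r : nat).
Hypothesis H : regular_mpt K e a r.

Lemma greedy_path v u m : v != u -> m < r ->
  exists s, [/\ size s = m, path e v s, uniq (v :: s) & u \notin v :: s].
Proof.
move=> vu; elim: m => [|m IHm] mr.
  by exists [::]; rewrite mem_seq1 eq_sym vu.
have [s [sz ps us un]] := IHm (ltnW mr).
have uX : uniq (u :: v :: s) by rewrite cons_uniq un.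
pose X := [set x in u :: v :: s].
have hX : last v s \in X by rewrite inE in_cons mem_last orbT.
have szX : #|X| = m.+2 by rewrite card_set_seq //= sz.
have h := out_avoid H hX; rewrite szX in h.
have : 0 < #|[set y | e (last v s) y] :\: X| by lia.
rewrite card_gt0 => /set0Pn[y]; rewrite in_setD !inE => /andP[].
rewrite !negb_or => /and3P[yu yv ys] ey.
exists (rcons s y); rewrite size_rcons sz rcons_path ps ey; split=> //.
  by rewrite -rcons_cons rcons_uniq us inE negb_or yv ys.
by rewrite -rcons_cons mem_rcons in_cons negb_or eq_sym yu.
Qed.

(** A greedy path from [v] is completed by a link to [u]: of two vertices for
    [l <= 5], of four vertices beyond, where the vertices to be avoided are
    [l - 4] in number. *)
Lemma short_paths v u l : v != u -> 4 <= l -> (l <= 5) || (2 * (l - 4) <= r) ->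
  path_of_length e v u l.
Proof.
move=> vu l4 hl; have a0 := class_gt0 H v; have dense := mpt_dense H.
pose k := if l <= 5 then 2 else 4.
have k_eq : l <= 5 /\ k = 2 \/ 5 < l /\ k = 4.
  by rewrite /k; case: leqP => h; [left|right].
have [|s [sz ps us un]] := @greedy_path v u (l - k - 2) vu; first lia.
have uX : uniq (u :: v :: s) by rewrite cons_uniq un.
have szX : #|[set x in u :: v :: s]| = l - k by rewrite card_set_seq //=; lia.
have xX : last v s \in [set x in u :: v :: s].
  by rewrite inE in_cons mem_last orbT.
have yX : u \in [set x in u :: v :: s] by rewrite !inE eqxx.
have [p [szp up aX pp]] : exists p, [/\ size p = k, uniq p,
    all (fun z => z \notin [set x in u :: v :: s]) p
    & path e (last v s) (rcons p u)].
  case: k_eq => [] [hl' ke]; rewrite ke in szX *.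
    by apply: (link2 H) => //; lia.
  by apply: (link4 H) => //; lia.
exists (s ++ rcons p u); split.
- by rewrite cat_path ps.
- by rewrite last_cat last_rcons.
- rewrite -cat_cons cat_uniq us rcons_uniq up andbT /=.
  have hp z : z \in p -> (z != u) && (z \notin v :: s).
    by move/(allP aX); rewrite !inE !negb_or.
  apply/andP; split; last by apply/negP => /hp; rewrite eqxx.
  apply/hasPn => z; rewrite mem_rcons in_cons => /orP[/eqP-> //|/hp/andP[] //].
- by rewrite /= size_cat size_rcons szp; lia.
Qed.
End Short.

(** * Inserting vertices into gaps of a path *)

(** Some consecutive p, q in [s] satisfy p -> f -> q.  Being the failure of a
    [sorted] property, it distributes over concatenation. *)
Definition has_gap (V : Type) (e : rel V) (f : V) (s : seq V) :=
  ~~ sorted (fun p q => ~~ (e p f && e f q)) s.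

Lemma has_gap_infix (V : Type) (e : rel V) (f : V) (s1 s s2 : seq V) :
  has_gap e f s -> has_gap e f (s1 ++ s ++ s2).
Proof.
apply: contra; case: s1 => [|x s1] /=.
  by case: s => [|y s] //=; rewrite cat_path => /andP[].
rewrite cat_path => /andP[_]; case: s => [|y s] //=.
by rewrite cat_path => /and3P[].
Qed.

Lemma insert_gap (V : Type) (e : rel V) (f : V) (s : seq V) :
  sorted e s -> has_gap e f s ->
  exists x s1 y s2, s = x :: s1 ++ y :: s2 /\ sorted e (x :: s1 ++ f :: y :: s2).
Proof.
case: s => [|x s] //= ps; rewrite /has_gap /=.
elim: s x ps => [|y s IHs] x //= /andP[exy ps].
rewrite negb_and negbK => /orP[/andP[exf efy]|/(IHs _ ps)].
  by exists x, [::], y, s; rewrite /= exf efy ps.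
move=> [x' [s1 [y' [s2 [[ey es] ps']]]]].
by exists x, (x' :: s1), y', s2; rewrite ey es /= -[X in e x X]ey exy.
Qed.

Section Insertion.
Variables (V : finType) (T : eqType) (K : V -> T) (e : rel V) (a r : nat).
Hypothesis H : regular_mpt K e a r.

(** If [g] falls into the gap p, q of [f], then [g] is adjacent to [f], and
    either p, g or g, q is a gap. *)
Lemma has_gap_insert f g s1 s2 : K g != K f ->
  has_gap e f (s1 ++ s2) -> has_gap e f (s1 ++ g :: s2).
Proof.
move=> Kgf; apply: contra; case: s1 => [|x s1] /=; first exact: path_sorted.
rewrite !cat_path /= => /and3P[-> /=]; case: s2 => [|y s2] //= hx /andP[hy ->].
rewrite andbT; apply: contra hx => /andP[-> efy]; apply: mpt_rev H _ _ Kgf _.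
by apply: contra hy => ->.
Qed.

(** All vertices of [m] are adjacent to [f], so the last vertex of the initial
    run of in-neighbours of [f] is followed by an out-neighbour. *)
Lemma gap_between f p m q : e p f -> e f q -> all (fun z => K z != K f) m ->
  has_gap e f (p :: rcons m q).
Proof.
move=> epf efq; elim: m p epf => [|z m IHm] p epf /=; rewrite /has_gap /=.
  by rewrite epf efq.
case/andP=> Kzf /(IHm z) h; have [ezf|nezf] := boolP (e z f).
  by rewrite negb_and negbK [X in _ || X]h ?orbT.
by rewrite epf (mpt_rev H Kzf nezf).
Qed.

Lemma insert_all L s : sorted e s -> uniq (map K L) ->
  all (fun f => has_gap e f s) L ->
  exists s', [/\ sorted e s', perm_eq s' (s ++ L),
    forall x, head x s' = head x s & forall x, last x s' = last x s].
Proof.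
elim: L s => [|f L IHL] s ps /=.
  by exists s; split; rewrite // cats0.
case/andP=> fL uL /andP[gf gL].
have [x [s1 [y [s2 [es ps']]]]] := insert_gap ps gf.
have [|s' [ps1 pe hh hl]] := IHL _ ps' uL.
  apply/allP => g gIL; rewrite -cat_cons; apply: has_gap_insert.
    by apply: contraNneq fL => ->; apply: map_f.
  by rewrite /= -es; apply: (allP gL).
exists s'; split=> //.
- apply: perm_trans pe _; rewrite es /= perm_cons -!catA perm_cat2l /=.
  by rewrite -(cat_cons y s2 (f :: L)) perm_sym perm_catC /= perm_cons perm_catC.
- by move=> x0; rewrite hh es.
- by move=> x0; rewrite hl es /= !last_cat.
Qed.

(** Redei's theorem: vertices of distinct classes induce a tournament, which
    has a Hamiltonian path. *)
Lemma redei L : uniq (map K L) -> exists s, sorted e s /\ perm_eq s L.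
Proof.
elim: L => [|f L IHL] /=; first by exists [::].
case/andP=> fL /IHL[s [ps pe]].
have hK z : z \in s -> K z != K f.
  by rewrite (perm_mem pe) => zL; apply: contraNneq fL => <-; apply: map_f.
case: s ps pe hK => [|x s] ps pe hK.
  by exists [:: f]; rewrite /= perm_cons.
have [efx|nefx] := boolP (e f x).
  by exists (f :: x :: s); rewrite /= efx perm_cons.
have exf : e x f by apply: mpt_rev H _ _ _ nefx; rewrite eq_sym hK ?mem_head.
have [elf|nelf] := boolP (e (last x s) f).
  exists (rcons (x :: s) f); rewrite perm_rcons perm_cons; split=> //.
  by rewrite /= rcons_path elf andbT.
have efl : e f (last x s) by apply: mpt_rev H _ _ _ nelf; rewrite hK ?mem_last.
have gf : has_gap e f (x :: s).
  case/lastP: s {ps pe nelf} hK efl => [|s y]; first by rewrite (negbTE nefx).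
  rewrite last_rcons => hK efy; apply: gap_between => //.
  by apply/allP => z zs; rewrite hK // inE mem_rcons inE zs !orbT.
have [|s' [ps' pe' _ _]] := @insert_all [:: f] (x :: s) ps isT.
  by rewrite /= gf.
exists s'; split=> //; apply: perm_trans pe' _.
by rewrite cats1 perm_rcons perm_cons.
Qed.
End Insertion.

(** * Pivots: vertices dominating a large part of a set *)

(** Rounding down matters: it lets the iterates of a small number reach 0. *)
Definition shrink (p q m : nat) := (p * m) %/ q.

Lemma shrink_mul p q m : q * shrink p q m <= p * m.
Proof. by rewrite mulnC; apply: leq_divM. Qed.

Lemma leq_shrink p q m1 m2 : m1 <= m2 -> shrink p q m1 <= shrink p q m2.
Proof. by move=> h; apply: leq_div2r; rewrite leq_mul2l h orbT. Qed.

Lemma leq_iter_shrink p q k m1 m2 :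
  m1 <= m2 -> iter k (shrink p q) m1 <= iter k (shrink p q) m2.
Proof. by move=> h; elim: k => //= k; apply: leq_shrink. Qed.

Section Pivots.
Variables (V : finType) (T : eqType) (K : V -> T) (e : rel V) (a r : nat).
Hypothesis H : regular_mpt K e a r.

(** Average over the vertices [y] outside [E].  Each vertex of [Z] has
    [r + a] non-in-neighbours, and those in [D] do not count since [D] is a
    part of [E]: this is how the pivots chosen before improve the average. *)
Lemma pivot_step (E D Z : {set V}) : D \subset E -> #|E| < #|V| ->
  {in D & Z, forall y z, ~~ e y z} ->
  exists2 y, y \notin E &
    #|[set z in Z | ~~ e y z]| * (#|V| - #|E|) <= #|Z| * (r + a - #|D|).
Proof.
move=> sDE EV hD; have [x xE] : exists x, x \notin E.
  apply/existsP; apply: contraTT EV; rewrite negb_exists => /forallP hE.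
  rewrite -leqNgt -cardsT; apply: subset_leq_card; apply/subsetP => z _.
  by move: (hE z); rewrite negbK.
have n_eq := order_mpt H x.
have hsum : \sum_(y in ~: E) #|[set z in Z | ~~ e y z]| <= #|Z| * (r + a - #|D|).
  rewrite (sum_card_rel (fun y z => ~~ e y z)); apply: sum_bound => z zZ.
  have := card_nonin H z; rewrite n_eq.
  have : #|[set y in ~: E | ~~ e y z]| + #|D| <= #|[set y | ~~ e y z]|.
    rewrite -cardsUI (_ : _ :&: _ = set0) ?cards0 ?addn0.
      apply: subset_leq_card; apply/subsetP => y; rewrite !inE.
      by case/orP => [/andP[]|/hD] //; apply.
    apply/setP => y; rewrite !inE; apply/negP => /andP[/andP[yE _] yD].
    by rewrite (subsetP sDE) in yE.
  lia.
have [//|hall] := boolP [exists y in ~: E,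
    #|[set z in Z | ~~ e y z]| * (#|V| - #|E|) <= #|Z| * (r + a - #|D|)].
  by move/exists_inP => [y]; rewrite inE => yE h; exists y.
have hE : #|~: E| = #|V| - #|E| by rewrite -(cardsC E) addKn.
move: hall; rewrite negb_exists_in => /forall_inP hall.
suff : \sum_(y in ~: E) (#|Z| * (r + a - #|D|)).+1 <=
       (\sum_(y in ~: E) #|[set z in Z | ~~ e y z]|) * (#|V| - #|E|).
  rewrite sum_nat_const hE mulnC leq_pmul2r ?subn_gt0 // => h.
  by have := leq_trans h hsum; rewrite ltnn.
rewrite big_distrl /=; apply: leq_sum => y yE.
by rewrite ltnNge hall.
Qed.

(** Iterating [pivot_step], each time forbidding the classes of the previous
    pivots.  The ratio p/q bounds the proportion of vertices that remain
    undominated at each of the [k] steps. *)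
Lemma pivots (x0 : V) p q k (E D Z : {set V}) m :
  0 < q -> D \subset E -> #|E| <= m -> m + k * a <= #|V| ->
  {in D & Z, forall y z, ~~ e y z} ->
  (forall i, i < k -> q * (r + a - #|D| - i) <= p * (#|V| - m - i * a)) ->
  exists s, [/\ size s = k, uniq (map K s), all (fun y => y \notin E) s &
    #|[set z in Z | all (fun y => ~~ e y z) s]| <= iter k (shrink p q) #|Z|].
Proof.
move=> q0; have a0 := class_gt0 H x0.
elim: k E D Z m => [|k IHk] E D Z m sDE Em mV hD hq.
  exists [::]; split=> //=; apply: subset_leq_card.
  by apply/subsetP => z; rewrite inE => /andP[].
have EV : #|E| < #|V| by lia.
have [y yE hy] := pivot_step sDE EV hD.
pose Z' := [set z in Z | ~~ e y z].
have hZ' : #|Z'| <= shrink p q #|Z|.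
  rewrite /shrink leq_divRL //.
  have h0 : q * (r + a - #|D|) <= p * (#|V| - #|E|).
    have := hq 0 isT; rewrite mul0n !subn0 => h; apply: leq_trans h _.
    by rewrite leq_mul2l leq_sub2l ?orbT.
  rewrite -(@leq_pmul2r (#|V| - #|E|)) ?subn_gt0 //.
  apply: (@leq_trans (#|Z| * (q * (r + a - #|D|)))).
    by rewrite mulnAC mulnCA mulnC leq_mul.
  by rewrite [p * _]mulnC -mulnA leq_mul.
have [|||||s [sz us aE hs]] := IHk (E :|: [set z | K z == K y]) (y |: D) Z' (m + a).
- rewrite subUset sub1set !inE eqxx orbT /=.
  exact: subset_trans sDE (subsetUl _ _).
- apply: leq_trans (leq_card_setU _ _) _; rewrite (mpt_class H); lia.
- lia.
- move=> z w; rewrite !inE => /orP[/eqP->|zD] /andP[wZ nyw] //; exact: hD.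
- move=> i ik; have := hq i.+1 ik; rewrite cardsU1.
  have -> : y \notin D by apply: contra yE; apply: (subsetP sDE).
  by rewrite /= mulSn; congr (_ <= _); congr (_ * _); lia.
exists (y :: s); rewrite /= sz us yE andbT; split=> //.
- apply/mapP => [[z zs eK]]; have := allP aE z zs.
  by rewrite !inE -eK eqxx orbT.
- by apply/allP => z /(allP aE); rewrite inE negb_or => /andP[].
rewrite -iterS iterSr; apply: leq_trans _ (leq_iter_shrink _ _ _ hZ').
apply: leq_trans _ hs; apply: subset_leq_card; apply/subsetP => z.
by rewrite !inE => /and3P[-> -> ->].
Qed.
End Pivots.

(** * Joining paths by links *)

Lemma sorted_link (V : Type) (e : rel V) x s l y t :
  path e x s -> path e (last x s) (rcons l y) -> path e y t ->
  sorted e ((x :: s) ++ l ++ y :: t).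
Proof.
move=> ps; rewrite rcons_path => /andP[pl ely] pt.
by rewrite /= cat_path ps cat_path pl /= ely.
Qed.

Section Join.
Variables (V : finType) (T : eqType) (K : V -> T) (e : rel V) (a r : nat).
Hypothesis H : regular_mpt K e a r.

(** The links are built from the last one to the first, each avoiding [X] and
    the links already made.  The last segment [g] is kept outside of [s] since
    it may be cut later. *)
Lemma join_segments (X : {set V}) gs g :
  2 * (#|X| + 4 * size gs) <= r + 8 ->
  all (fun s => (s != [::]) && sorted e s) (g :: gs) ->
  {subset flatten gs ++ g <= X} ->
  exists s l, [/\ sorted e (s ++ g), perm_eq s (flatten gs ++ l),
    size l = 4 * size gs, uniq l & all (fun z => z \notin X) l] /\
  [/\ subseq (flatten gs) s,
    forall f s', s' \in gs -> has_gap e f s' -> has_gap e f s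
    & forall x, head x (s ++ g) = head x (flatten gs ++ g)].
Proof.
move=> hX /= /andP[/andP[g0 pg] pgs].
elim: gs hX pgs => [|g1 gs IHgs] hX /=; first by exists [::], [::].
case/andP=> [/andP[g10 pg1] pgs] sub.
have sub' : {subset flatten gs ++ g <= X}.
  by move=> z hz; apply: sub; rewrite -catA mem_cat hz orbT.
have [|s [l [[ps pe sl ul al] [ss gp hd]]]] := IHgs _ pgs sub'.
  by move: hX => /=; lia.
case: g1 g10 pg1 sub hX => [//|x1 s1] _ pg1 sub hX.
have [y [t et]] : exists y t, s ++ g = y :: t.
  case: (s ++ g) (size_cat s g) => [|y t]; last by exists y, t.
  by case: (g) g0 => //= ? ? _; rewrite addnS.
pose X' := X :|: [set z in l].
have cX' : #|X'| = #|X| + 4 * size gs.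
  rewrite -sl -(card_set_seq ul) -cardsUI (_ : _ :&: _ = set0) ?cards0 ?addn0 //.
  by apply/setP => z; rewrite !inE; apply/negP => /andP[zX /(allP al)]; rewrite zX.
have [|||l1 [sl1 ul1 al1 pl1]] := @link4 _ _ _ _ _ _ H X' (last x1 s1) y.
- by rewrite cX'; move: hX => /=; lia.
- by rewrite !inE sub // -catA mem_cat mem_last.
- have : y \in s ++ g by rewrite et mem_head.
  rewrite mem_cat (perm_mem pe) mem_cat => /orP[/orP[]|] hy; rewrite !inE.
  + by rewrite sub' // mem_cat hy.
  + by rewrite hy orbT.
  + by rewrite sub' // mem_cat hy orbT.
exists ((x1 :: s1) ++ l1 ++ s), (l1 ++ l); split; split.
- rewrite -!catA et; apply: sorted_link => //.
  by move: ps; rewrite et.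
- rewrite -!catA perm_cat2l; apply: (@perm_trans _ (l1 ++ flatten gs ++ l)).
    by rewrite perm_cat2l.
  by rewrite perm_catCA.
- by rewrite size_cat sl sl1 mulnS.
- rewrite cat_uniq ul1 ul andbT; apply/hasPn => z zl; apply/negP => zl1.
  by have := allP al1 z zl1; rewrite !inE zl orbT.
- rewrite all_cat al andbT; apply/allP => z /(allP al1).
  by rewrite inE negb_or => /andP[].
- by rewrite cat_subseq // -[flatten gs]cat0s cat_subseq ?sub0seq.
- move=> f s'; rewrite inE => /orP[/eqP->|s'gs] gf.
    exact: (@has_gap_infix _ e f [::] (x1 :: s1) (l1 ++ s) gf).
  rewrite catA -[s]cats0; apply: has_gap_infix.
  exact: gp gf.
- by [].
Qed.
End Join.

(** * Cycle factors of large induced subdigraphs *)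

Section Factor.
Variables (V : finType) (T : eqType) (K : V -> T) (e : rel V) (a r : nat).
Hypothesis H : regular_mpt K e a r.

(** The vertices whose image is reached by an arc: a permutation of the
    complement of [X] is a cycle factor when all its points are good. *)
Definition good_tails (X : {set V}) (s : {perm V}) := [set x in ~: X | e x (s x)].

(** Shifting the images of [s] along [c] makes all of [c] good, including the
    bad vertex [x0], and changes nothing elsewhere. *)
Lemma augment_factor (X : {set V}) (s : {perm V}) x0 c :
  perm_on (~: X) s -> uniq c -> x0 \in c -> {in c, forall x, x \notin X} ->
  path.cycle (fun x y => e x (s y)) c -> ~~ e x0 (s x0) ->
  exists2 s' : {perm V}, perm_on (~: X) s' & #|good_tails X s| < #|good_tails X s'|.
Proof.
move=> ps uc x0c cX cyc bad.
have inj : injective (fun x => s (next c x)).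
  by apply: inj_comp; [apply: perm_inj | apply: can_inj (prev_next uc)].
have out x : x \notin c -> next c x = x by rewrite next_nth => /negbTE ->.
have in_c x : x \in c -> e x (s (next c x)) by move/(next_cycle cyc).
exists (perm inj).
  apply/subsetP => x; rewrite !inE permE; have [xc _|xc] := boolP (x \in c).
    exact: cX.
  by rewrite out // => nx; have := subsetP ps x; rewrite !inE; apply.
apply: proper_card; apply/properP; split.
  apply/subsetP => x; rewrite !inE permE => /andP[-> /=].
  by have [xc|xc] := boolP (x \in c); [rewrite in_c | rewrite out].
by exists x0; rewrite !inE ?permE ?in_c ?cX // (negbTE bad) andbF.
Qed.

(** Take a permutation with the largest number of good points and suppose that
    x0 is bad.  Let R be the set of vertices reachable from x0 by alternating
    steps x, y with an arc from x to the image of y.  An arc from R to the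
    image of x0 would allow [augment_factor]; so no arc leads from R to the
    set B of all points that are not images of R minus x0.  But |R| + |B|
    exceeds the number of points, contradicting [no_arc_bound] applied in both
    directions. *)
Lemma cycle_factor (X : {set V}) : 3 * #|X| + 5 * a < 2 * r + 5 ->
  exists2 s : {perm V}, perm_on (~: X) s & forall x, x \notin X -> e x (s x).
Proof.
move=> hX; pose P (s : {perm V}) := perm_on (~: X) s.
have P1 : P 1%g by exact: perm_on1.
case: (arg_maxnP (fun s => #|good_tails X s|) P1) => s Ps smax.
exists s => // x0 x0X; apply: contraT => bad.
pose g x y := (y \notin X) && e x (s y).
pose R := [set t | connect g x0 t].
have sX x : (s x \in X) = (x \in X).
  have := perm_closed x Ps; rewrite !inE => h; exact: negb_inj.
have RX t : t \in R -> t \notin X.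
  rewrite inE => /connectP[p pp ->]; elim/last_ind: p pp => [|p z _] //.
  by rewrite last_rcons rcons_path => /andP[_ /andP[]].
have noaug t : t \in R -> ~~ e t (s x0).
  rewrite inE => /connectP[p pp ->]; case/shortenP: pp => q pq uq _.
  apply/negP => elast.
  have [|||||s' Ps' lt] := @augment_factor X s x0 (x0 :: q) Ps => //.
  - exact: mem_head.
  - move=> z; rewrite inE => /orP[/eqP-> //|zq].
    have : z \in R by rewrite inE; apply: (path_connect pq); rewrite inE zq orbT.
    exact: RX.
  - rewrite /= rcons_path elast andbT; apply: sub_path pq.
    by move=> y z /andP[].
  - by move: lt; rewrite ltnNge; apply/negP; rewrite negbK; apply: smax.
pose B := ~: X :\: (s @: (R :\ x0)).
have x0R : x0 \in R by rewrite inE connect0.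
have noarc : {in R & B, forall t y, ~~ e t y}.
  move=> t y tR; rewrite !inE => /andP[yR yX]; apply/negP => ety.
  have yE : y = s (s^-1 y)%g by rewrite permKV.
  have y'X : (s^-1 y)%g \notin X by rewrite -sX -yE.
  have y'R : (s^-1 y)%g \in R.
    move: tR; rewrite !inE => tR; apply: connect_trans tR _; apply: connect1.
    by rewrite /g y'X -yE.
  move: yR; rewrite {1}yE mem_imset ?in_setD1 ?y'R ?andbT; last exact: perm_inj.
  rewrite negbK => /eqP y'0; move: ety; rewrite yE y'0.
  by apply/negP; apply: noaug.
have x0B : s x0 \in B.
  by rewrite !inE sX x0X andbT mem_imset ?inE ?eqxx //; apply: perm_inj.
have hB : #|~: X| <= #|B| + #|R :\ x0|.
  rewrite -(cardsID (s @: (R :\ x0)) (~: X)) addnC leq_add2l.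
  apply: leq_trans (leq_imset_card s (R :\ x0)).
  exact: subset_leq_card (subsetIr _ _).
have hR : #|R| = (#|R :\ x0|).+1 by rewrite (cardsD1 x0 R) x0R.
have n_eq := order_mpt H x0; have := cardsC X; rewrite n_eq => cX.
have R0 : R != set0 by apply/set0Pn; exists x0.
have B0 : B != set0 by apply/set0Pn; exists (s x0).
have h1 := no_arc_bound H R0 noarc.
have h2 : #|B| + 2 * #|R| + 1 <= 2 * r + 4 * a.
  apply: (no_arc_bound (converse_mpt H) B0) => y t yB tR.
  exact: noarc.
move: #|~: X| #|R :\ x0| #|R| #|B| #|X| h1 h2 hR hB hX cX; lia.
Qed.
End Factor.

(** * Merging a path and a cycle *)

Ltac count_simpl := repeat (first [rewrite count_cat | progress simpl]).

Lemma split_first (V : Type) (p : pred V) s : has p s ->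
  exists s1 x s2, [/\ s = s1 ++ x :: s2, p x & all (predC p) s1].
Proof.
elim: s => //= x s IHs; have [px _|npx /= /IHs[s1 [y [s2 [-> py ps]]]]] := boolP (p x).
  by exists [::], x, s.
by exists (x :: s1), y, s2; split=> //=; rewrite npx.
Qed.

(** A cycle opened after [y]: the path from the successor [z] of [y] to [y]. *)
Lemma cycle_ending_at (V : eqType) (e : rel V) (C : seq V) y :
  (forall x, ~~ e x x) -> path.cycle e C -> y \in C ->
  exists z c, [/\ perm_eq C (z :: c), path e z c, e (last z c) z & last z c = y].
Proof.
move=> irr cC yC; case: (rot_to yC) => i t et.
have : path.cycle e (y :: t) by rewrite -et rot_cycle.
have pC : perm_eq C (y :: t) by rewrite -et perm_sym perm_rot.
case: t et pC => [|z t] et pC /=; first by rewrite (negbTE (irr y)).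
rewrite rcons_path => /andP[eyz /andP[pt ety]]; exists z, (rcons t y).
rewrite last_rcons rcons_path pt ety eyz; split=> //.
by apply: perm_trans pC _; rewrite -rcons_cons perm_sym perm_rcons.
Qed.

Section Merge.
Variables (V : finType) (T : eqType) (K : V -> T) (e : rel V) (a r : nat).
Hypothesis H : regular_mpt K e a r.

Lemma dominates_noin x y : ~~ e y x -> K y != K x -> e x y.
Proof. by move=> nyx nK; apply: mpt_rev H _ _ nK nyx. Qed.

Ltac perm_count := apply/seq.permP => ?; count_simpl; clear; lia.

(** The merging argument of Gutin, by induction along the path.  No vertex of
    the cycle dominates [x], hence [x] dominates all of them outside its own
    class, and the cycle can be entered from [x] nearly everywhere.  If no
    vertex of the cycle dominates the successor x' of [x] either, x' takes the
    place of [x].  Otherwise some y on the cycle dominates x', and opening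
    the cycle after y allows insertion between [x] and x', unless the successor
    z of y shares the class of [x].  In this case the first vertex h after x'
    that does not dominate z, which exists because the path ends with a vertex
    dominating nothing on the cycle, gives a way to place z between h and its
    predecessor g, unless h also shares the class of [x]; then h takes the
    place of [x], unless some w on the cycle dominates h, and a few detours
    through w and the vertices following it remain.  All members of one class
    being non-adjacent, neighbours of z, h and w' on the paths lie outside
    the class of [x]. *)
Lemma absorb_cycle C : path.cycle e C -> C != [::] ->
  forall n s x t, size t <= n -> sorted e (s ++ x :: t) ->
  (forall y, y \in C -> ~~ e y x) ->
  (forall y, y \in C -> ~~ e (last x t) y) ->
  exists2 p, sorted e p & perm_eq p (s ++ x :: t ++ C).
Proof.
move=> cC C0; elim=> [|n IHn] s x t.
  rewrite leqn0 size_eq0 => /eqP-> _ noin noout.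
  case: C cC C0 noin noout => // y C cC _ noin noout.
  have [z [c [pC pz ez ey]]] := cycle_ending_at (mpt_irr H) cC (mem_head y C).
  exfalso; have yC : y \in y :: C by rewrite mem_head.
  have zC : z \in y :: C by rewrite (perm_mem pC) mem_head.
  have nKz : K z = K x.
    apply/eqP; apply: contraT => nK.
    by have := noout z zC; rewrite /= dominates_noin ?noin.
  have := noout y yC; rewrite /= dominates_noin ?noin // -nKz.
  by rewrite (mpt_arc_class H) // -ey.
case: t => [|x' t] tn; first by apply: IHn.
rewrite sorted_cat_cons => /andP[ps /= /andP[exx' pt]] noin noout.
have [noin'|] := boolP (all (fun y => ~~ e y x') C).
  have [||||p pp pe] := IHn (rcons s x) x' t => //.
  - by rewrite cat_rcons sorted_cat_cons ps /= exx'.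
  - exact/allP.
  by exists p => //; apply: perm_trans pe _; rewrite cat_rcons.
case/allPn => y yC; rewrite negbK => eyx'.
have [z [c [pC pz ez ly]]] := cycle_ending_at (mpt_irr H) cC yC.
(* it is enough to rearrange the vertices after [x] together with the cycle *)
have fin p : path e x p -> perm_eq p (x' :: t ++ z :: c) ->
    exists2 p, sorted e p & perm_eq p (s ++ x :: (x' :: t) ++ C).
  move=> pp pe; exists (s ++ x :: p); first by rewrite sorted_cat_cons ps.
  rewrite perm_cat2l perm_cons; apply: perm_trans pe _.
  by rewrite -cat_cons perm_cat2l perm_sym.
have noinz w : w \in z :: c -> ~~ e w x by rewrite -(perm_mem pC); apply: noin.
have nooutz w : w \in z :: c -> ~~ e (last x' t) w by rewrite -(perm_mem pC); apply: noout.
have [exz|nexz] := boolP (e x z).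
  apply: (fin ((z :: c) ++ x' :: t)); last by perm_count.
  by rewrite /= exz cat_path pz /= ly eyx'.
have Kzx : K z = K x.
  apply/eqP; apply: contraT => nK.
  by rewrite dominates_noin ?noinz ?mem_head in nexz.
case: c pC pz ez ly fin noinz nooutz => [|z2 c] pC pz ez ly fin noinz nooutz.
  by move: ez; rewrite /= (negbTE (mpt_irr H z)).
have xdom w : w \in z :: z2 :: c -> K w != K x -> e x w.
  by move=> wC; apply: dominates_noin; apply: noinz.
move: (pz) => /= /andP[ezz2 pc].
have exz2 : e x z2.
  by rewrite xdom ?inE ?eqxx ?orbT // -Kzx eq_sym (mpt_arc_class H).
have [ezx'|nezx'] := boolP (e z x').
  apply: (fin ((z2 :: c) ++ z :: x' :: t)); last by perm_count.
  by rewrite /= exz2 cat_path pc /= ez ezx'.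
have ex'z : e x' z.
  apply: dominates_noin => //; rewrite Kzx; exact: mpt_arc_class H _ _ exx'.
have hasM : has (fun w => ~~ e w z) t.
  case: t pt nooutz {tn noout fin} => [|w t] pt nooutz.
    by have := nooutz z (mem_head _ _); rewrite /= ex'z.
  apply/hasP; exists (last w t); first exact: mem_last.
  exact: nooutz (mem_head _ _).
(* h is the first vertex after x' that does not dominate z, and g precedes h *)
have [M [h [B [et nehz aM]]]] := split_first hasM.
subst t; move: pt; rewrite cat_path /= => /and3P[pM egh pB]; set g := last x' M in egh.
have Mz w : w \in x' :: M -> e w z.
  by rewrite inE => /orP[/eqP->|/(allP aM)] //=; rewrite negbK.
have egz : e g z by apply: Mz; apply: mem_last.
have [ezh|nezh] := boolP (e z h).
  apply: (fin ((z2 :: c) ++ x' :: M ++ z :: h :: B)).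
    rewrite /= exz2 cat_path pc /=; rewrite /= in ly; rewrite ly eyx' cat_path pM /=.
    by rewrite -/g egz ezh.
  by perm_count.
have Khx : K h = K x.
  rewrite -Kzx; apply/eqP; apply: contraT => nK.
  by rewrite dominates_noin // eq_sym in nehz *.
have [noinh|] := boolP (all (fun w => ~~ e w h) C).
  have [||||p pp pe] := IHn (s ++ x :: x' :: M) h B.
  - by move: tn; rewrite /= size_cat /=; clear; lia.
  - by rewrite -catA sorted_cat_cons ps /= exx' cat_path pM /= -/g egh.
  - exact/allP.
  - by move=> w wC; have := noout w wC; rewrite /= last_cat.
  exists p => //; apply: perm_trans pe _.
  by perm_count.
case/allPn => w; rewrite (perm_mem pC) inE => /orP[/eqP->|].
  by rewrite (negbTE nezh).
move=> wC; rewrite negbK => ewh.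
have [t1 [t2 ec]] : exists t1 t2, z2 :: c = t1 ++ w :: t2.
  by case/splitPr: wC => t1 t2; exists t1, t2.
rewrite ec in pz ez ly fin xdom; clear ec pc exz2 ezz2 wC pC.
move: pz ez ly; rewrite !last_cat cat_path /=.
move=> /and3P[p1 elw p2] elz ly.
case: t2 p2 elz ly fin xdom => [|w' t2] p2 elz ly fin xdom.
  apply: (fin (x' :: M ++ z :: t1 ++ w :: h :: B)); last by perm_count.
  by rewrite /= exx' cat_path pM /= -/g egz cat_path p1 /= elw ewh pB.
move: p2 elz ly => /= /andP[eww' p2] elz ly.
have [Kw'|nKw'] := eqVneq (K w') (K x); last first.
  apply: (fin (w' :: t2 ++ x' :: M ++ z :: t1 ++ w :: h :: B)).
    rewrite /= xdom ?inE ?mem_cat ?inE ?eqxx ?orbT // cat_path p2 /= ly eyx'.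
    by rewrite cat_path pM /= -/g egz cat_path p1 /= elw ewh pB.
  by perm_count.
have nKg : K w' != K g by rewrite Kw' -Khx eq_sym (mpt_arc_class H).
have [egw'|negw'] := boolP (e g w').
  apply: (fin (x' :: M ++ w' :: t2 ++ z :: t1 ++ w :: h :: B)).
    rewrite /= exx' cat_path pM /= -/g egw' cat_path p2 /= elz cat_path p1 /=.
    by rewrite elw ewh pB.
  by perm_count.
have ew'g : e w' g by apply: mpt_rev H _ _ _ negw'; rewrite eq_sym.
case: t2 p2 elz ly fin xdom => [|w2 t2] p2 elz ly fin xdom.
  by have := mpt_arc_class H elz; rewrite /= Kw' Kzx eqxx.
move: p2 elz ly => /= /andP[ew'w2 p2] elz ly.
have exw2 : e x w2.
  rewrite xdom ?inE ?mem_cat ?inE ?eqxx ?orbT //.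
  by rewrite -Kw' eq_sym (mpt_arc_class H).
case/lastP: M pM @g egh egz nKg negw' ew'g fin Mz {aM nooutz noout tn hasM}
    => [|M g0] pM g egh egz nKg negw' ew'g fin Mz.
  apply: (fin (w2 :: t2 ++ z :: t1 ++ w :: w' :: x' :: h :: B)).
    rewrite /= exw2 cat_path p2 /= elz cat_path p1 /= elw eww' /=.
    by rewrite -/g ew'g egh pB.
  by perm_count.
have gE : g = g0 by rewrite /g last_rcons.
have elMz : e (last x' M) z.
  by apply: Mz; have := mem_last x' M; rewrite !inE mem_rcons inE orbCA => ->; rewrite orbT.
rewrite rcons_path -gE in pM; case/andP: pM => pM elMg.
apply: (fin (w2 :: t2 ++ x' :: M ++ z :: t1 ++ w :: w' :: g :: h :: B)).
  rewrite /= exw2 cat_path p2 /= ly eyx' cat_path pM /= elMz cat_path p1 /=.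
  by rewrite elw eww' ew'g egh pB.
by rewrite -cats1 -gE; perm_count.
Qed.
End Merge.

(** * Hamiltonian paths of large induced subdigraphs *)

Section Ham.
Variables (V : finType) (T : eqType) (K : V -> T) (e : rel V) (a r : nat).
Hypothesis H : regular_mpt K e a r.

(** Immediate if an arc leads from the cycle to the head of the path or from
    its last vertex to the cycle; otherwise [absorb_cycle] applies. *)
Lemma path_cycle_merge p C : sorted e p -> path.cycle e C ->
  exists2 q, sorted e q & perm_eq q (p ++ C).
Proof.
move=> pp cC; have [->|C0] := eqVneq C [::]; first by exists p; rewrite ?cats0.
case: p pp => [|x t] pp.
  case: C cC {C0} => [|y C]; first by exists [::].
  by rewrite /= rcons_path => /andP[pC _]; exists (y :: C).
have [hin|hin] := boolP (has (fun y => e y x) C).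
  case/hasP: hin => y yC eyx.
  have [z [c [pC pz _ ly]]] := cycle_ending_at (mpt_irr H) cC yC.
  exists ((z :: c) ++ x :: t); first by rewrite /= cat_path pz /= ly eyx; apply: pp.
  by rewrite perm_catC perm_cat2l perm_sym.
have [hout|hout] := boolP (has (fun y => e (last x t) y) C).
  case/hasP: hout => y yC ely; case: (rot_to yC) => i c ec.
  have : path.cycle e (y :: c) by rewrite -ec rot_cycle.
  rewrite /= rcons_path => /andP[pc _].
  exists ((x :: t) ++ y :: c); first by rewrite /= cat_path [path _ _ _]pp /= ely.
  by rewrite perm_cat2l -ec perm_rot.
have [||q pq eq] := @absorb_cycle _ _ _ _ _ _ H C cC C0 _ [::] x t (leqnn _) pp.
- by move=> y yC; move/hasPn/(_ y yC): hin.
- by move=> y yC; move/hasPn/(_ y yC): hout.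
by exists q.
Qed.

(** The orbits of [s] are the cycles of the factor; they are merged one by one
    into the path. *)
Lemma factor_ham_path (s : {perm V}) (U : {set V}) :
  {in U, forall x, s x \in U} -> {in U, forall x, e x (s x)} ->
  exists p, [/\ sorted e p, uniq p & p =i U].
Proof.
move: {2}#|U| (leqnn #|U|) => n; elim: n U => [|n IHn] U.
  rewrite leqn0 cards_eq0 => /eqP-> _ _; exists [::]; split=> // x.
  by rewrite inE.
move=> Un sU eU; have [->|/set0Pn[x xU]] := eqVneq U set0.
  by exists [::]; split=> // x; rewrite inE.
have sinj := @perm_inj _ s; pose C := fingraph.orbit s x.
have CU y : y \in C -> y \in U.
  rewrite /C -fconnect_orbit => /connectP[p + ->].
  elim: p (x) xU => //= z p IHp x' x'U /andP[/eqP <- pp].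
  by apply: IHp pp; apply: sU.
pose U' := U :\: [set y in C].
have [|||p [pp up pU]] := IHn U'.
- rewrite -ltnS; apply: leq_trans _ Un; apply: proper_card; apply/properP.
  split; first exact: subsetDl.
  by exists x => //; rewrite !inE /C fingraph.in_orbit.
- move=> y; rewrite !inE => /andP[yC yU]; rewrite sU // andbT.
  by apply: contra yC; rewrite /C -!fconnect_orbit -same_fconnect1_r.
- by move=> y; rewrite inE => /andP[_]; apply: eU.
have cC : path.cycle e C.
  apply: (@sub_in_cycle _ [in U] (frel s)); last exact: cycle_orbit.
    by move=> y z yU _ /eqP <-; apply: eU.
  by apply/allP.
have [q pq eq] := path_cycle_merge pp cC.
exists q; split=> //.
  rewrite (perm_uniq eq) cat_uniq up fingraph.orbit_uniq andbT; apply/hasPn => y yC.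
  by rewrite /= pU !inE yC.
move=> y; rewrite (perm_mem eq) mem_cat pU !inE.
by case: (boolP (y \in C)) => [/CU->|]; rewrite ?orbT ?orbF.
Qed.

Lemma ham_path_avoiding (X : {set V}) : 3 * #|X| + 5 * a < 2 * r + 5 ->
  exists p, [/\ sorted e p, uniq p & p =i ~: X].
Proof.
move=> hX; have [s ps es] := cycle_factor H hX.
apply: (@factor_ham_path s) => x; rewrite !inE => xX; last exact: es.
by have := perm_closed x ps; rewrite !inE => ->.
Qed.
End Ham.

(** * Dominating families and mass insertion *)

Section Families.
Variables (V : finType) (T : eqType) (K : V -> T) (e : rel V) (a r : nat).
Hypothesis H : regular_mpt K e a r.

Lemma card_classes (L : seq V) : #|[set z | K z \in map K L]| <= size L * a.
Proof.
elim: L => [|x L IHL] /=.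
  by rewrite (_ : [set z | _] = set0) ?cards0 //; apply/setP => z; rewrite !inE.
apply: (@leq_trans #|[set z | K z == K x] :|: [set z | K z \in map K L]|).
  by apply: subset_leq_card; apply/subsetP => z; rewrite !inE.
by apply: leq_trans (leq_card_setU _ _) _; rewrite (mpt_class H) mulSn leq_add2l.
Qed.

Lemma card_seq_set (L : seq V) : #|[set z in L]| <= size L.
Proof. by rewrite cardsE card_size. Qed.

(** The first dominator [y] is arbitrary and misses r + a - 1 vertices besides
    itself; the further ones are pivots for those.  They are arranged as a path
    by [redei]. *)
Lemma dominators (x0 : V) p q k (E : {set V}) m :
  0 < q -> #|E| <= m -> m + a + k * a <= #|V| ->
  (forall i, i < k -> q * (r + a - 1 - i) <= p * (#|V| - m - a - i * a)) ->
  exists s, [/\ sorted e s, size s = k.+1, uniq (map K s),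
    all (fun y => y \notin E) s &
    #|[set z | (z \notin s) && all (fun y => ~~ e y z) s]|
      <= iter k (shrink p q) (r + a - 1)].
Proof.
move=> q0 Em mV hq; have a0 := class_gt0 H x0; have n_eq := order_mpt H x0.
have [y yE] : exists y, y \notin E.
  apply/existsP; apply: contraT; rewrite negb_exists => /forallP hE.
  suff : #|V| <= #|E| by lia.
  rewrite -cardsT; apply: subset_leq_card; apply/subsetP => z _.
  by move: (hE z); rewrite negbK.
pose Z := [set z | ~~ e y z] :\ y.
have cZ : #|Z| = r + a - 1.
  have := cardsD1 y [set z | ~~ e y z]; rewrite (card_nonout H) inE (mpt_irr H) -/Z.
  rewrite n_eq; lia.
have [|||||s [sz us sE hs]] := @pivots _ _ _ _ _ _ H y p q k
   (E :|: [set z | K z == K y]) [set y] Z (m + a) q0.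
- by rewrite sub1set !inE eqxx orbT.
- by apply: leq_trans (leq_card_setU _ _) _; rewrite (mpt_class H) leq_add2r.
- by rewrite n_eq in mV *; lia.
- by move=> w z; rewrite !inE => /eqP-> /andP[].
- by move=> i ik; rewrite cards1 subnDA; apply: hq.
have us' : uniq (map K (y :: s)).
  rewrite /= us andbT; apply/mapP => [[z zs eK]]; have := allP sE z zs.
  by rewrite !inE -eK eqxx orbT.
have [t [pt pe]] := redei H us'; exists t; split=> //.
- by rewrite (perm_size pe) /= sz.
- by rewrite (perm_uniq (perm_map K pe)).
- rewrite (perm_all _ pe) /= yE; apply/allP => z /(allP sE).
  by rewrite inE negb_or => /andP[].
rewrite -cZ; apply: leq_trans hs; apply: subset_leq_card; apply/subsetP => z.
rewrite !inE (perm_mem pe) (perm_all _ pe) inE negb_or /=.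
by move=> /andP[/andP[-> _] /andP[-> ->]].
Qed.

(** The form of [gap_between] in which in- and out-neighbours are known only by
    their order on the path. *)
Lemma gap_of_subseq f p q s : subseq [:: p; q] s -> e p f -> e f q ->
  all (fun z => K z != K f) s -> has_gap e f s.
Proof.
move=> + epf efq; elim: s => // x s IHs; rewrite [all _ _]/= => ss /andP[_ aK].
move: ss; rewrite [subseq _ _]/=; case: eqP => [ex|_]; last first.
  move=> /IHs /(_ aK) g; have := has_gap_infix [:: x] [::] g.
  by rewrite cats0.
rewrite sub1seq -ex => qs; case/splitPr: qs aK => s1 s2; rewrite all_cat.
case/andP=> aK _; rewrite -cat_rcons -cat_cons.
exact: (@has_gap_infix _ e f [::] _ s2 (gap_between H epf efq aK)).
Qed.

Lemma gap_insert_all v u s L : sorted e s -> uniq s -> s != [::] ->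
  head u s = v -> last v s = u -> uniq (map K L) ->
  all (fun f => (f \notin s) && has_gap e f s) L ->
  path_of_length e v u (size s + size L).
Proof.
move=> ps us s0 hs ls uL aL.
have [|s' [ps' pe hd lt]] := insert_all H ps uL.
  by apply/allP => f /(allP aL)/andP[].
have us' : uniq s'.
  rewrite (perm_uniq pe) cat_uniq us (map_uniq uL) andbT.
  by apply/hasPn => f /(allP aL)/andP[].
case: s' ps' pe hd lt us' => [|x t] pt pe hd lt ut.
  by move: s0; rewrite -size_eq0; have := perm_size pe; rewrite size_cat /=; lia.
have xv : x = v by rewrite -hs -(hd u).
exists t; rewrite -xv; split=> //.
- by have := lt v; rewrite ls.
- by rewrite (perm_size pe) size_cat.
Qed.

End Families.

(** * Dominating families when the classes are singletons *)

Lemma flatten_map_seq1 (V : Type) (s : seq V) : flatten [seq [:: x] | x <- s] = s.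
Proof. by elim: s => //= x s ->. Qed.

Lemma sorted_converse_rev (V : Type) (e : rel V) s :
  sorted (converse e) s = sorted e (rev s).
Proof. by rewrite rev_sorted. Qed.

Section Singletons.
Variables (V : finType) (T : eqType) (K : V -> T) (e : rel V) (r : nat).
Hypothesis H : regular_mpt K e 1 r.

Lemma class_inj : injective K.
Proof.
move=> x y eK; have /eqP/cards1P[z ez] := mpt_class H x.
have : x \in [set z] by rewrite -ez inE.
have : y \in [set z] by rewrite -ez inE eK.
by rewrite !inE => /eqP-> /eqP->.
Qed.

Lemma card_nonout1 v : #|[set z | ~~ e v z] :\ v| = r.
Proof.
have := cardsD1 v [set z | ~~ e v z].
by rewrite (card_nonout H) inE (mpt_irr H) (order_mpt H v); lia.
Qed.

Lemma card_nonin1 v : #|[set z | ~~ e z v] :\ v| = r.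
Proof.
have := cardsD1 v [set z | ~~ e z v].
by rewrite (card_nonin H) inE (mpt_irr H) (order_mpt H v); lia.
Qed.

(** The pivots for Q have ratio 46/91 and those for S, which also avoid Q, have
    ratio 46/85, as 46 <= r; and (91/46)^6 > 59, (85/46)^7 > 73. *)
Lemma singleton_families v u : v != u ->
  exists Q S, [/\ sorted e Q, sorted e S, size Q = 6, size S = 7
    & uniq (v :: u :: Q ++ S)] /\
   59 * #|[set z in [set z | ~~ e v z] :\ v | all (fun y => ~~ e y z) Q]| <= r /\
   73 * #|[set z in [set z | ~~ e z u] :\ u | all (fun y => ~~ e z y) S]| <= r.
Proof.
move=> vu; have n_eq := order_mpt H v; have dense := mpt_dense H.
have [||||||Q' [sQ' uQ' EQ' hQ']] := @pivots _ _ _ _ _ _ H v 46 91 6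
   [set v; u] [set v] ([set z | ~~ e v z] :\ v) 2 => //.
- by apply/subsetP => z; rewrite !inE => ->.
- by rewrite cards2; case: (_ != _).
- by lia.
- by move=> y z; rewrite !inE => /eqP-> /andP[].
- by move=> i i6; rewrite cards1 n_eq; lia.
have [Q [pQ eQ]] := redei H uQ'.
have uQ : uniq Q by rewrite (perm_uniq eQ) (map_uniq uQ').
have sQ : size Q = 6 by rewrite (perm_size eQ).
have [||||||S' [sS' uS' ES' hS']] := @pivots _ _ _ _ _ _ (converse_mpt H) v 46 85 7
   ([set v; u] :|: [set z in Q]) [set u] ([set z | ~~ e z u] :\ u) 8 => //.
- by apply/subsetP => z; rewrite !inE => ->; rewrite orbT.
- apply: leq_trans (leq_card_setU _ _) _; rewrite cards2 vu card_set_seq ?sQ //.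
- by lia.
- by move=> y z; rewrite !inE => /eqP-> /andP[].
- by move=> i i6; rewrite cards1 n_eq; lia.
have [S [pS eS]] := redei (converse_mpt H) uS'.
exists Q, (rev S); split; split.
- by [].
- by rewrite -sorted_converse_rev.
- by [].
- by rewrite size_rev (perm_size eS).
- have hQ z : z \in Q -> (z != v) && (z != u).
    by rewrite (perm_mem eQ) => /(allP EQ'); rewrite !inE negb_or.
  have hS z : z \in S -> [&& z != v, z != u & z \notin Q].
    by rewrite (perm_mem eS) => /(allP ES'); rewrite !inE !negb_or -andbA.
  rewrite /= !inE !mem_cat !mem_rev (negbTE vu) cat_uniq uQ rev_uniq.
  rewrite (perm_uniq eS) (map_uniq uS') andbT /= !negb_or.
  apply/and3P; split.
  + by apply/andP; split; apply/negP; [move/hQ | move/hS]; rewrite eqxx.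
  + by apply/andP; split; apply/negP; [move/hQ | move/hS]; rewrite eqxx /= ?andbF.
  + by apply/hasPn => z; rewrite mem_rev => /hS/and3P[].
- rewrite (eq_card (_ : _ =i [set z in [set z | ~~ e v z] :\ v |
      all (fun y => ~~ e y z) Q'])); last first.
    by move=> z; rewrite !inE (perm_all _ eQ).
  move: hQ'; rewrite card_nonout1; move: #|_| => z /=.
  have h1 := shrink_mul 46 91 r; set m1 := shrink 46 91 r in h1 *.
  have h2 := shrink_mul 46 91 m1; set m2 := shrink 46 91 m1 in h2 *.
  have h3 := shrink_mul 46 91 m2; set m3 := shrink 46 91 m2 in h3 *.
  have h4 := shrink_mul 46 91 m3; set m4 := shrink 46 91 m3 in h4 *.
  have h5 := shrink_mul 46 91 m4; set m5 := shrink 46 91 m4 in h5 *.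
  have h6 := shrink_mul 46 91 m5; move: h1 h2 h3 h4 h5 h6; clear.
  by lia.
- rewrite (eq_card (_ : _ =i [set z in [set z | ~~ e z u] :\ u |
      all (fun y => ~~ converse e y z) S'])); last first.
    by move=> z; rewrite !inE all_rev (perm_all _ eS).
  move: hS'; rewrite card_nonin1; move: #|_| => z /=.
  have h1 := shrink_mul 46 85 r; set m1 := shrink 46 85 r in h1 *.
  have h2 := shrink_mul 46 85 m1; set m2 := shrink 46 85 m1 in h2 *.
  have h3 := shrink_mul 46 85 m2; set m3 := shrink 46 85 m2 in h3 *.
  have h4 := shrink_mul 46 85 m3; set m4 := shrink 46 85 m3 in h4 *.
  have h5 := shrink_mul 46 85 m4; set m5 := shrink 46 85 m4 in h5 *.
  have h6 := shrink_mul 46 85 m5; set m6 := shrink 46 85 m5 in h6 *.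
  have h7 := shrink_mul 46 85 m6; move: h1 h2 h3 h4 h5 h6 h7; clear.
  by lia.
Qed.
End Singletons.

(** * All path lengths when the classes are singletons *)

Section SingletonPaths.
Variables (V : finType) (T : eqType) (K : V -> T) (e : rel V) (r : nat).
Hypothesis H : regular_mpt K e 1 r.

(** Vertices without an in-neighbour among v, Q or without an out-neighbour
    among S, u are put on the path themselves.  With z of these there are
    3 + z links, hence 27 + 5z vertices in all, and the rates 1/59 and 1/73 of
    exceptions leave 46 + 10z <= r. *)
Lemma singleton_base v u : v != u ->
  exists s, [/\ sorted e s, uniq s & s != [::]] /\
   [/\ head u s = v, last v s = u, 2 * (size s - 4) <= r
     & forall x, x \notin s -> has_gap e x s].
Proof.
move=> vu; have [Q [S [[pQ pS sQ sS uX] [hQ hS]]]] := singleton_families H vu.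
have dense := mpt_dense H.
set ZQ := [set z in _ | _] in hQ; set ZS := [set z in _ | _] in hS.
pose X0 := [set z in v :: u :: Q ++ S].
have cX0 : #|X0| = 15 by rewrite card_set_seq //= size_cat sQ sS.
pose Z := (ZQ :|: ZS) :\: X0.
have cZ : #|Z| <= #|ZQ| + #|ZS|.
  apply: leq_trans (leq_card_setU _ _); exact: subset_leq_card (subsetDl _ _).
pose zs := enum Z; have szs : size zs = #|Z| by rewrite -cardE.
have uzs : uniq zs by exact: enum_uniq.
have zsE z : (z \in zs) = (z \in Z) by rewrite mem_enum.
pose X := X0 :|: Z.
have cX : #|X| = 15 + #|Z|.
  by rewrite /X cardsU cX0 setIDA setDIl setDv set0I cards0 subn0.
pose F := v :: u :: Q ++ S ++ zs.
have FE : F = (v :: u :: Q ++ S) ++ zs by rewrite /F catA.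
have XE z : (z \in X) = (z \in F).
  by rewrite in_setU [z \in X0]inE -zsE FE mem_cat.
have pF : perm_eq ((v :: Q ++ S ++ zs) ++ [:: u]) F.
  by rewrite perm_catC -(cat1s v) perm_catCA.
pose gs := [:: v] :: Q :: S :: [seq [:: z] | z <- zs].
have fgs : flatten gs = v :: Q ++ S ++ zs by rewrite /= flatten_map_seq1.
have hr : 46 + 10 * #|Z| <= r by lia.
have sgs : size gs = 3 + #|Z| by rewrite /= size_map szs.
have Q0 : Q != [::] by rewrite -size_eq0 sQ.
have S0 : S != [::] by rewrite -size_eq0 sS.
have [|||s [l [[ps pe sl ul al] [ss _ hd]]]] :=
  @join_segments _ _ _ _ _ _ H X gs [:: u].
- by rewrite cX sgs; move: hr; clear; lia.
- by rewrite /= Q0 pQ S0 pS /=; apply/allP => t /mapP[z _ ->].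
- by move=> z; rewrite fgs XE (perm_mem pF).
have lX z : z \in l -> z \notin X by move/(allP al).
have uF : uniq F.
  rewrite FE cat_uniq uX uzs andbT; apply/hasPn => z.
  by rewrite zsE in_setD [z \in X0]inE => /andP[].
have permS : perm_eq (s ++ [:: u]) (F ++ l).
  apply: perm_trans (perm_cat pe (perm_refl _)) _; rewrite fgs perm_catAC.
  exact: perm_cat pF (perm_refl _).
have us : uniq (s ++ [:: u]).
  rewrite (perm_uniq permS) cat_uniq uF ul andbT; apply/hasPn => z /lX.
  by rewrite XE.
have szs' : size (s ++ [:: u]) = 27 + 5 * #|Z|.
  rewrite size_cat (perm_size pe) size_cat sl sgs fgs /= !size_cat sQ sS szs.
  by clear; lia.
exists (s ++ [:: u]); split; split=> //.
- by case: (s).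
- by rewrite last_cat.
- by rewrite szs'; move: hr; clear; lia.
move=> x xs; have nK z : z != x -> K z != K x.
  by apply: contra => /eqP/(class_inj H)->.
have xF : x \notin F.
  by apply: contra xs => xF; rewrite (perm_mem permS) mem_cat xF.
have /andP[xZ xX0] : (x \notin Z) && (x \notin X0).
  by rewrite -negb_or orbC -in_setU XE.
have [p pv epx] : exists2 p, p \in v :: Q & e p x.
  have : x \notin ZQ by apply: contra xZ => h; rewrite inE xX0 inE h.
  have xv : x != v by apply: contraNneq xF => ->; rewrite mem_head.
  rewrite !inE xv /= negb_and negbK => /orP[evx|/allPn[y yQ]]; first by exists v; rewrite ?mem_head.
  by rewrite negbK => eyx; exists y; rewrite // inE yQ orbT.
have [q qu exq] : exists2 q, q \in S ++ zs ++ [:: u] & e x q.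
  have : x \notin ZS by apply: contra xZ => h; rewrite inE xX0 inE h orbT.
  have xu : x != u by apply: contraNneq xF => ->; rewrite !inE eqxx orbT.
  rewrite !inE xu /= negb_and negbK => /orP[exu|/allPn[y yS]].
    by exists u; rewrite // !mem_cat !inE eqxx !orbT.
  by rewrite negbK => exy; exists y; rewrite // mem_cat yS.
apply: (gap_of_subseq H _ epx exq).
  apply: (@subseq_trans _ (flatten gs ++ [:: u])); last by rewrite cat_subseq.
  rewrite fgs -cat_cons -!catA -[[:: p; q]]/([:: p] ++ [:: q]).
  by rewrite cat_subseq // sub1seq.
by apply/allP => z zs'; apply: nK; apply: contraNneq xs => <-.
Qed.

Lemma singleton_paths v u l : v != u -> 4 <= l <= #|V| -> path_of_length e v u l.
Proof.
move=> vu /andP[l4 lV]; have [hl|hl] := leqP (2 * (l - 4)) r.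
  by apply: (short_paths H vu l4); rewrite hl orbT.
have [s [[ps us s0] [hs ls bs gs]]] := singleton_base vu.
pose R := enum [set x | x \notin s]; pose L := take (l - size s) R.
have sR : size R = #|V| - size s.
  rewrite -cardE -(card_set_seq us) -(cardsC [set x in s]) addKn.
  by apply: eq_card => x; rewrite !inE.
have sL : size L = l - size s by rewrite size_take sR; case: ltnP => //; move: lV; clear; lia.
have -> : l = size s + size L by rewrite sL; move: bs hl; clear; lia.
apply: (gap_insert_all H) => //.
  rewrite (map_inj_uniq (class_inj H)); exact: take_uniq (enum_uniq _).
by apply/allP => f /mem_take; rewrite mem_enum inE => fs; rewrite fs gs.
Qed.
End SingletonPaths.

(** * Dominating families when the classes are not singletons *)

(** The ratios are p1/q1 for the 8 dominators on the side of [v] and p2/q2 for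
    the 9 ones on the side of [u], whose choice avoids the classes of the
    former.  The first inequality says that the skeleton, of 45 + 5z vertices,
    has at most 4 + r/2 of them; the second one is what the link inside the
    block needs, which avoids 15 whole classes and 14 + z vertices.  For
    [a = 2] the degree may be as small as 92, and sharper ratios are needed than
    those available for larger classes. *)
Lemma shrink_numerics r a : 46 * a <= r -> 2 <= a ->
  exists p1 q1 p2 q2, [/\ 0 < q1, 0 < q2,
   forall i, i < 7 -> q1 * (r + a - 1 - i) <= p1 * (2 * r - 2 - i * a),
   forall i, i < 8 ->
     q2 * (r + a - 1 - i) <= p2 * (2 * r - 2 - 8 * a - i * a) &
   let z := iter 7 (shrink p1 q1) (r + a - 1) +
            iter 8 (shrink p2 q2) (r + a - 1) in
    82 + 10 * z <= r /\ 28 + 30 * a + 2 * z <= r].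
Proof.
have shrink7 p q m : let f i := iter i (shrink p q) m in
    [/\ q * f 1 <= p * m, q * f 2 <= p * f 1, q * f 3 <= p * f 2,
        q * f 4 <= p * f 3 & q * f 5 <= p * f 4] /\
    [/\ q * f 6 <= p * f 5, q * f 7 <= p * f 6 & q * f 8 <= p * f 7].
  by split; split; apply: shrink_mul.
move=> dense ge2; have [a3|a3] := leqP 3 a.
  exists 47, 86, 47, 77; split=> //.
  - move=> i i7; have : i * a + (6 - i) * 3 <= 6 * a by move: i7 a3; clear; nia.
    by move: i7 dense a3; clear; lia.
  - move=> i i8; have : i * a + (7 - i) * 3 <= 7 * a by move: i8 a3; clear; nia.
    by move: i8 dense a3; clear; lia.
  have [[]] := shrink7 47 86 (r + a - 1).
  move: (iter 1 _ _) (iter 2 _ _) (iter 3 _ _) (iter 4 _ _) (iter 5 _ _) (iter 6 _ _).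
  move: (iter 7 _ _) (iter 8 _ _) => z1 y x1 x2 x3 x4 x5 x6.
  move=> h1 h2 h3 h4 h5 [h6 h7 _].
  have {h1 h2 h3 h4 h5 h6 h7} hz1 : 68 * z1 <= r + a - 1.
    by move: h1 h2 h3 h4 h5 h6 h7; clear; lia.
  have [[]] := shrink7 47 77 (r + a - 1).
  move: (iter 1 _ _) (iter 2 _ _) (iter 3 _ _) (iter 4 _ _) (iter 5 _ _) (iter 6 _ _).
  move: (iter 7 _ _) (iter 8 _ _) => w7 z2 w1 w2 w3 w4 w5 w6.
  move=> h1 h2 h3 h4 h5 [h6 h7 h8].
  have {h1 h2 h3 h4 h5 h6 h7 h8} hz2 : 51 * z2 <= r + a - 1.
    by move: h1 h2 h3 h4 h5 h6 h7 h8; clear; lia.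
  by move: hz1 hz2 dense a3; clear => /=; lia.
have {ge2 a3} ea : a = 2 by move: ge2 a3; clear; lia.
rewrite ea in dense *; exists 87, 170, 43, 76; split=> //.
- by move=> i; move: dense; clear; lia.
- by move=> i; move: dense; clear; lia.
have [[]] := shrink7 87 170 (r + 2 - 1).
move: (iter 1 _ _) (iter 2 _ _) (iter 3 _ _) (iter 4 _ _) (iter 5 _ _) (iter 6 _ _).
move: (iter 7 _ _) (iter 8 _ _) => z1 y x1 x2 x3 x4 x5 x6.
move=> h1 h2 h3 h4 h5 [h6 h7 _].
have {h1 h2 h3 h4 h5 h6 h7} hz1 : 108 * z1 <= r + 1.
  by move: h1 h2 h3 h4 h5 h6 h7; clear; lia.
have [[]] := shrink7 43 76 (r + 2 - 1).
move: (iter 1 _ _) (iter 2 _ _) (iter 3 _ _) (iter 4 _ _) (iter 5 _ _) (iter 6 _ _).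
move: (iter 7 _ _) (iter 8 _ _) => w7 z2 w1 w2 w3 w4 w5 w6.
move=> h1 h2 h3 h4 h5 [h6 h7 h8].
have {h1 h2 h3 h4 h5 h6 h7 h8} hz2 : 95 * z2 <= r + 1.
  by move: h1 h2 h3 h4 h5 h6 h7 h8; clear; lia.
by move: hz1 hz2 dense; clear => /=; lia.
Qed.

Section BigClasses.
Variables (V : finType) (T : eqType) (K : V -> T) (e : rel V) (a r : nat).
Hypothesis H : regular_mpt K e a r.
Hypothesis a2 : 2 <= a.

(** The second family is a family of [dominators] of the converse, reversed. *)
Lemma dominating_families p1 q1 p2 q2 v u : v != u -> 0 < q1 -> 0 < q2 ->
  (forall i, i < 7 -> q1 * (r + a - 1 - i) <= p1 * (2 * r - 2 - i * a)) ->
  (forall i, i < 8 -> q2 * (r + a - 1 - i) <= p2 * (2 * r - 2 - 8 * a - i * a)) ->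
  exists Q S, [/\ sorted e Q, sorted e S, size Q = 8 & size S = 9] /\
   [/\ uniq (map K (Q ++ S)), uniq (v :: u :: Q ++ S),
     #|[set z | (z \notin Q) && all (fun y => ~~ e y z) Q]|
       <= iter 7 (shrink p1 q1) (r + a - 1) &
     #|[set z | (z \notin S) && all (fun y => ~~ e z y) S]|
       <= iter 8 (shrink p2 q2) (r + a - 1)].
Proof.
move=> vu q10 q20 hq1 hq2; have n_eq := order_mpt H v; have dense := mpt_dense H.
have [|||Q [pQ sQ uQ EQ hQ]] := @dominators _ _ _ _ _ _ H v p1 q1 7 [set v; u] 2 q10.
- by rewrite cards2 vu.
- by rewrite n_eq; lia.
- move=> i i7; rewrite n_eq.
  by rewrite (_ : 2 * r + a - 2 - a = 2 * r - 2) ?hq1 //; lia.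
pose E := [set v; u] :|: [set z | K z \in map K Q].
have [|||S [pS sS uS ES hS]] := @dominators _ _ _ _ _ _ (converse_mpt H) v p2 q2 8 E
   (2 + 8 * a) q20.
- apply: leq_trans (leq_card_setU _ _) _; rewrite cards2 vu leq_add2l -sQ.
  exact: card_classes H Q.
- by rewrite n_eq; lia.
- move=> i i8; rewrite n_eq.
  rewrite (_ : 2 * r + a - (2 + 8 * a) - a = 2 * r - 2 - 8 * a) ?hq2 //; lia.
have hQ' z : z \in Q -> (z != v) && (z != u).
  by move/(allP EQ); rewrite !inE negb_or.
have hS' z : z \in S -> [&& z != v, z != u & K z \notin map K Q].
  by move/(allP ES); rewrite !inE !negb_or -andbA.
have uK : uniq (map K (Q ++ rev S)).
  rewrite map_cat cat_uniq uQ map_rev rev_uniq uS andbT; apply/hasPn => k.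
  by rewrite mem_rev => /mapP[z /hS'/and3P[_ _ ?] ->].
exists Q, (rev S); split; split=> //.
- by rewrite -sorted_converse_rev.
- by rewrite size_rev.
- rewrite /= !inE (negbTE vu) (map_uniq uK) !mem_cat !mem_rev !negb_or /= andbT.
  apply/andP; split.
  + by apply/andP; split; apply/negP; [move/hQ' | move/hS']; rewrite eqxx.
  + by apply/andP; split; apply/negP; [move/hQ' | move/hS']; rewrite eqxx /= ?andbF.
- apply: leq_trans hS; rewrite leq_eqVlt; apply/orP; left; apply/eqP.
  by apply: eq_card => z; rewrite !inE mem_rev all_rev.
Qed.

Lemma few_exceptions v u : v != u ->
  exists Q S, [/\ sorted e Q, sorted e S, size Q = 8 & size S = 9] /\
   [/\ uniq (map K (Q ++ S)), uniq (v :: u :: Q ++ S) &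
    let z := #|[set z | (z \notin Q) && all (fun y => ~~ e y z) Q]| +
             #|[set z | (z \notin S) && all (fun y => ~~ e z y) S]| in
    82 + 10 * z <= r /\ 28 + 30 * a + 2 * z <= r].
Proof.
move=> vu.
have [p1 [q1 [p2 [q2 [h1 h2 h3 h4 h5]]]]] := shrink_numerics (mpt_dense H) a2.
have [Q [S [h [k1 k2 k3 k4]]]] := dominating_families vu h1 h2 h3 h4.
exists Q, S; split=> //; split=> //; move: h5 (leq_add k3 k4).
move: (_ + #|_|) (_ + iter _ _ _) => z1 z2 /=; clear; lia.
Qed.
End BigClasses.

(** * Dominators on both sides of the skipped vertices *)

Section Dominators.
Variables (V : finType) (T : eqType) (K : V -> T) (e : rel V) (a r : nat).
Hypothesis H : regular_mpt K e a r.
Hypothesis a2 : 2 <= a.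

(** Each pivot leaves at most 33/50 of the 15 vertices undominated; rounded
    down, 15 becomes 9, 5, 3, 1 and 0. *)
Lemma five_dominators (F : seq V) (E : {set V}) : size F = 15 -> #|E| <= 9 ->
  exists Q, [/\ sorted e Q, size Q = 5, uniq Q,
    {in Q, forall z, (z \notin E) && (K z \notin map K F)} &
    {in F, forall f, exists2 y, y \in Q & e y f}].
Proof.
case: F => // f0 F; set F' := f0 :: F => sF hE.
have n_eq := order_mpt H f0; have dense := mpt_dense H.
have hZ : #|[set f in F']| <= 15 by rewrite -sF; apply: card_seq_set.
have [|||||Q [sQ uQ EQ hQ]] := @pivots _ _ _ _ _ _ H f0 33 50 5
   (E :|: [set z | K z \in map K F']) set0 [set f in F'] (9 + 15 * a) isT.
- exact: sub0set.
- apply: leq_trans (leq_card_setU _ _) _; apply: leq_add => //.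
  by rewrite -sF; apply: card_classes H _.
- by rewrite n_eq; move: dense a2; clear; lia.
- by move=> y z; rewrite in_set0.
- move=> i i5; rewrite n_eq cards0.
  have : i * a + (4 - i) * 2 <= 4 * a by move: i5 a2; clear; nia.
  by move: dense a2 i5; clear; lia.
have [t [pt pe]] := redei H uQ; exists t; split=> //.
- by rewrite (perm_size pe).
- by rewrite (perm_uniq pe) (map_uniq uQ).
- by move=> z; rewrite (perm_mem pe) => /(allP EQ); rewrite !inE negb_or.
move=> f fF; have : #|[set z in [set f1 in F'] | all (fun y => ~~ e y z) Q]| <= 0.
  by apply: leq_trans hQ (leq_trans (leq_iter_shrink _ _ _ hZ) _).
rewrite leqn0 cards_eq0 => /eqP/setP/(_ f); rewrite inE [f \in _]inE in_set0.
move: fF => -> /= /negbT/allPn[y yQ]; rewrite negbK => eyf.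
by exists y; rewrite // (perm_mem pe).
Qed.

End Dominators.

Section Block.
Variables (V : finType) (T : eqType) (K : V -> T) (e : rel V) (a r : nat).
Hypothesis H : regular_mpt K e a r.
Hypothesis a2 : 2 <= a.

Lemma two_sided_dominators (F : seq V) (E : {set V}) :
  size F = 15 -> #|E| <= 4 ->
  exists Q S, [/\ sorted e Q, sorted e S, size Q = 5 & size S = 5] /\
  [/\ uniq (Q ++ S), {in Q ++ S, forall z, (z \notin E) && (K z \notin map K F)},
    {in F, forall f, exists2 y, y \in Q & e y f} &
    {in F, forall f, exists2 y, y \in S & e f y}].
Proof.
move=> sF hE; have [|Q [pQ sQ uQ EQ hQ]] := five_dominators H a2 sF (E := E).
  exact: leq_trans hE _.
pose E' := E :|: [set z in Q].
have [|S' [pS sS uS ES hS]] := five_dominators (converse_mpt H) a2 sF (E := E').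
  apply: leq_trans (leq_card_setU _ _) _.
  by rewrite card_set_seq // sQ (leq_add hE (leqnn 5)).
have hS' z : z \in S' -> [&& z \notin E, z \notin Q & K z \notin map K F].
  by move/ES; rewrite !inE negb_or -andbA.
exists Q, (rev S'); split; split=> //.
- by rewrite -sorted_converse_rev.
- by rewrite size_rev.
- rewrite cat_uniq uQ rev_uniq uS andbT; apply/hasPn => z; rewrite mem_rev.
  by case/hS'/and3P.
- move=> z; rewrite mem_cat mem_rev => /orP[/EQ //|/hS'/and3P[-> _ ->] //].
- by move=> f /hS[y yS efy]; exists y; rewrite // mem_rev.
Qed.
End Block.

(** * All path lengths when the classes are not singletons *)

Section Long.
Variables (V : finType) (T : eqType) (K : V -> T) (e : rel V) (a r : nat).
Hypothesis H : regular_mpt K e a r.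
Hypothesis a2 : 2 <= a.

(** Neither the link nor [Q] and [O] meet the classes of [F], so [gap_between]
    applies to every vertex of [F]. *)
Lemma link_block (F Q O : seq V) (X : {set V}) :
  2 * #|X| <= r -> {subset Q ++ O <= X} -> (forall z, K z \in map K F -> z \in X) ->
  sorted e Q -> sorted e O -> Q != [::] -> O != [::] ->
  {in Q ++ O, forall z, K z \notin map K F} ->
  {in F, forall f, exists2 y, y \in Q & e y f} ->
  {in F, forall f, exists2 y, y \in O & e f y} ->
  exists l, [/\ size l = 4, uniq l, all (fun z => z \notin X) l,
    sorted e (Q ++ l ++ O) & {in F, forall f, has_gap e f (Q ++ l ++ O)}].
Proof.
move=> hX sub cls pQ pO + + nF hQ hO.
case: Q pQ sub nF hQ => // x Q pQ sub nF hQ _.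
case: O pO sub nF hO => // y O pO sub nF hO _.
have [||l [sl ul al pl]] := link4 H hX (x := last x Q) (y := y).
- by apply: sub; rewrite mem_cat mem_last.
- by apply: sub; rewrite mem_cat mem_head orbT.
exists l; split=> //; first exact: sorted_link.
move=> f fF; have [p pQ' pf] := hQ f fF; have [q qO fq] := hO f fF.
apply: (gap_of_subseq H (p := p) (q := q)) => //.
  rewrite -[[:: p; q]]cat1s cat_subseq ?sub1seq //.
  by rewrite mem_cat qO orbT.
apply/allP => z zs; apply/negP => /eqP zf; have zF : K z \in map K F by rewrite zf map_f.
move: zs; rewrite !mem_cat orbCA -mem_cat => /orP[zl|/nF]; last by rewrite zF.
by have := allP al z zl; rewrite cls.
Qed.

(** Only the first vertex of [Q] and the last one of [S] are
    certain to stay on the path; [s] has gaps for all others, in a block of 14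
    vertices.  The vertices violating the domination, z in number, are put on
    [s].  Thus [s] consists of [v], the block, these z vertices and z + 2 links,
    and the whole skeleton has 45 + 5z vertices. *)
Lemma skeleton v u : v != u ->
  exists s Q S l,
  [/\ sorted e (s ++ Q), sorted e (S ++ rcons l u), uniq (s ++ Q ++ S ++ rcons l u),
      head u s = v & s != [::]] /\
  [/\ uniq (map K (Q ++ S)),
   {in behead Q ++ belast (head u S) (behead S), forall f, has_gap e f s},
   forall x, x \notin s ++ Q ++ S ++ rcons l u -> has (fun y => e y x) Q && has (e x) S &
   2 * (size (s ++ Q ++ S ++ rcons l u) - 4) <= r /\
   3 * size (s ++ Q ++ S ++ rcons l u) + 5 * a < 2 * r + 5].
Proof.
move=> vu; have dense := mpt_dense H.
have [D [S [[pD pS sD sS] [uK uX [hr1 hr2]]]]] := few_exceptions H a2 vu.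
move: hr1 hr2; set ZD := [set z | _]; set ZS := [set z | _] => hr1 hr2.
have D0 : D != [::] by rewrite -size_eq0 sD.
pose q := head u D; pose t := last u S; pose F := behead D ++ belast (head u S) (behead S).
have sF : size F = 15 by rewrite size_cat size_belast !size_behead sD sS.
pose E := [set v; u; q; t].
have hE : #|E| <= 4.
  apply: leq_trans (leq_card_setU _ _) _; rewrite cards1 addn1 ltnS.
  apply: leq_trans (leq_card_setU _ _) _; rewrite cards1 addn1 ltnS.
  by rewrite cards2; case: (_ != _).
have [Q [O [[pQ pO sQ sO] [uQO nQO hQ hO]]]] := two_sided_dominators H a2 sF hE.
have eD : D = q :: behead D by rewrite /q; case: (D) D0.
have eS : S = rcons (belast (head u S) (behead S)) t.
  by rewrite /t; case: (S) sS => //= x s _; rewrite -lastI.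
pose X0 := [set z in v :: u :: D ++ S ++ Q ++ O].
pose Z := (ZD :|: ZS) :\: X0.
have cZ : #|Z| <= #|ZD| + #|ZS|.
  apply: leq_trans (leq_card_setU _ _); exact: subset_leq_card (subsetDl _ _).
pose zs := enum Z; have szs : size zs = #|Z| by rewrite -cardE.
have uzs : uniq zs by exact: enum_uniq.
have zsE z : (z \in zs) = (z \in Z) by rewrite mem_enum.
have {}hr1 : 82 + 10 * size zs <= r by rewrite szs; move: hr1 cZ; clear; lia.
have {}hr2 : 28 + 30 * a + 2 * size zs <= r.
  by rewrite szs; move: hr2 cZ; clear; lia.
have memDS z : z \in D ++ S -> [|| z == q, z == t | z \in F].
  rewrite eD eS !mem_cat !inE mem_rcons inE => /orP[/orP[]|/orP[]] ->; rewrite ?orbT //.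
pose G0 := v :: u :: D ++ S ++ Q ++ O.
have uG0 : uniq G0.
  have eG : G0 = (v :: u :: D ++ S) ++ (Q ++ O) by rewrite /G0 /= -catA.
  rewrite eG cat_uniq uX uQO andbT; apply/hasPn => z /nQO/andP[zE zF].
  move: zE; rewrite !inE !negb_or -!andbA => /and4P[zv zu zq zt].
  rewrite (negbTE zv) (negbTE zu) /=; apply/negP => /memDS.
  rewrite (negbTE zq) (negbTE zt) /= => /(map_f K); exact/negP.
have uFX : uniq (G0 ++ zs).
  rewrite cat_uniq uG0 uzs andbT; apply/hasPn => z; rewrite zsE in_setD => /andP[+ _].
  by rewrite [z \in X0]inE.
have sG0 : size G0 = 29 by rewrite /G0 /= !size_cat sD sS sQ sO.
(* the block link must avoid the classes of F; of D and S, only q and t remain *)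
pose X1 := [set z in v :: u :: q :: t :: Q ++ O ++ zs] :|: [set z | K z \in map K F].
have subX1 : {subset G0 ++ zs <= X1}.
  move=> z; rewrite in_setU [z \in [set _ in _]]inE [z \in [set _ | _]]inE.
  rewrite mem_cat /G0 !in_cons catA [_ \in (D ++ S) ++ _]mem_cat.
  rewrite !mem_cat => zG; apply: contraT; rewrite !negb_or -!andbA.
  case/and5P => z1 z2 z3 z4 /and4P[z5 z6 z7 z8]; move: zG.
  rewrite (negbTE z1) (negbTE z2) (negbTE z5) (negbTE z6) (negbTE z7) /= !orbF.
  rewrite -mem_cat => /memDS; rewrite (negbTE z3) (negbTE z4) /= => /(map_f K).
  by rewrite (negbTE z8).
have cX1 : #|X1| <= 14 + size zs + 15 * a.
  apply: leq_trans (leq_card_setU _ _) _; apply: leq_add.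
    by apply: leq_trans (card_seq_set _) _; rewrite /= !size_cat sQ sO.
  by rewrite -sF; apply: card_classes H _.
have [||||||l0 [sl0 ul0 al0 pB gB]] := @link_block F Q O X1 _ _ _ pQ pO _ _ _ hQ hO.
- by move: cX1 hr2; clear; lia.
- move=> z zQO; apply: subX1; rewrite /G0 mem_cat !in_cons catA.
  by rewrite [z \in _ ++ (Q ++ O)]mem_cat zQO !orbT.
- by move=> z zF; rewrite in_setU; apply/orP; right; rewrite inE; exact: zF.
- by rewrite -size_eq0 sQ.
- by rewrite -size_eq0 sO.
- by move=> z /nQO/andP[].
pose B := Q ++ l0 ++ O.
pose X2 := [set z in (G0 ++ zs) ++ l0].
have uX2 : uniq ((G0 ++ zs) ++ l0).
  rewrite cat_uniq uFX ul0 andbT; apply/hasPn => z zl; apply/negP => /subX1.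
  exact/negP/(allP al0).
have cX2 : #|X2| = 33 + size zs.
  by rewrite card_set_seq // size_cat [size (_ ++ zs)]size_cat sG0 sl0; clear; lia.
pose gs := [:: v] :: B :: [seq [:: z] | z <- zs].
have sgs : size gs = size zs + 2 by rewrite /gs /= size_map addn2.
have fgs : flatten gs = v :: B ++ zs by rewrite /gs /= flatten_map_seq1.
have [|||s [l1 [[ps pe sl1 ul1 al1] [ss gp hd]]]] := @join_segments _ _ _ _ _ _ H X2 gs D.
- by rewrite cX2 sgs; move: hr1; clear; lia.
- rewrite /= pD D0 pB all_map /= (_ : all _ _ = true) ?andbT; last exact/allP.
  by rewrite -size_eq0 !size_cat sQ.
- rewrite fgs => z; rewrite [z \in X2]inE /G0 /B !(mem_cat, inE).
  by case/orP=> [/orP[|/orP[/or3P[]|]]|] ->; rewrite ?(orbT, orTb).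
have uX3 : uniq (((G0 ++ zs) ++ l0) ++ l1).
  rewrite cat_uniq uX2 ul1 andbT; apply/hasPn => z zl; apply/negP => zX.
  by have := allP al1 z zl; rewrite inE zX.
pose X3 := [set z in ((G0 ++ zs) ++ l0) ++ l1].
have cX3 : #|X3| = 41 + 5 * size zs.
  rewrite card_set_seq // size_cat [size (_ ++ l0)]size_cat [size (_ ++ zs)]size_cat.
  by rewrite sG0 sl0 sl1 sgs; clear; lia.
have [|||l [sl ul al pl]] := link4 H (X := X3) (x := t) (y := u).
- by rewrite cX3; move: hr1; clear; lia.
- by rewrite inE /G0 eS !(mem_cat, mem_rcons, inE) eqxx !orbT.
- by rewrite inE /G0 !(mem_cat, inE) eqxx !orbT.
have pP : perm_eq (s ++ D ++ S ++ rcons l u) ((((G0 ++ zs) ++ l0) ++ l1) ++ l).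
  apply/seq.permP => p; rewrite /G0 -cats1; move/seq.permP/(_ p): pe; rewrite fgs /B.
  by count_simpl; clear; lia.
have sP : size (s ++ D ++ S ++ rcons l u) = 45 + 5 * size zs.
  rewrite (perm_size pP) size_cat sl -(card_set_seq uX3) -/X3 cX3; clear; lia.
exists s, D, S, l; rewrite sP; split; split=> //.
- move: pS pl; rewrite /t; case: (S) sS => //= x1 s1 _ pS pl.
  by rewrite cat_path pS.
- rewrite (perm_uniq pP) cat_uniq uX3 ul andbT; apply/hasPn => z zl; apply/negP => zX.
  by have := allP al z zl; rewrite inE zX.
- have := hd v; rewrite fgs /=.
  case: s pe {ps ss gp hd pP sP} => [|x s] pe; last by [].
  by have := perm_size pe; rewrite fgs.
- by have := perm_size pe; rewrite -size_eq0 fgs /= => ->.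
- move=> f fF; apply: (gp f B); last exact: gB.
  by rewrite /gs !inE eqxx orbT.
- move=> x; rewrite (perm_mem pP) mem_cat negb_or => /andP[+ _].
  rewrite mem_cat negb_or => /andP[+ _]; rewrite mem_cat negb_or => /andP[+ _].
  rewrite mem_cat negb_or => /andP[xG xz]; move: xz.
  rewrite zsE in_setD [x \in X0]inE xG /= in_setU negb_or !inE.
  move: xG; rewrite !inE !mem_cat !negb_or => /and5P[_ _ xD xS _]; rewrite xD xS /=.
  by move=> /andP[/allPn[y yD] + /allPn[y' yS]]; rewrite !negbK => eyx exy;
    apply/andP; split; apply/hasP; [exists y|exists y'].
- by split; move: hr1 hr2; clear; lia.
Qed.

(** The prefix of length [m] minus the size of the skeleton of a Hamiltonian
    path of the remaining vertices is attached to the skeleton, and the bypassed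
    vertices of [Q] and [S] move to their gaps in [s].  The skeleton being
    shorter than [m], that prefix is nonempty. *)
Lemma long_paths v u m : v != u -> r < 2 * (m - 4) -> m <= #|V| ->
  path_of_length e v u m.
Proof.
move=> vu rm mV.
have [s [Q [S [l [[psQ pSl uX hds s0] [uK gs dom [Xr Xa]]]]]]] := skeleton vu.
move: uX dom Xr Xa; set X := s ++ _ => uX dom Xr Xa.
have cX := card_set_seq uX.
have [|h [ph uh hE]] := ham_path_avoiding H (X := [set x in X]); first by rewrite cX.
have sh : size h = #|V| - size X by rewrite -(card_uniqP uh) -cX (eq_card hE) cardsCs setCK.
pose t := m - size X.
have [t0 th] : 0 < t /\ t <= size h.
  by rewrite sh /t; move: Xr rm mV; clear; lia.
have tX : size X + t = m by rewrite /t; move: Xr rm; clear; lia.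
have stk : size (take t h) = t by rewrite size_take_min; apply/minn_idPl.
have hpX : {in take t h, forall x, x \notin X}.
  by move=> x /mem_take; rewrite hE !inE.
have uhp := take_uniq t uh; have php := take_sorted t ph.
move: stk hpX uhp php; case: (take t h) => [|h1 ht]; first by move: t0; rewrite lt0n => /negP t0 /esym/eqP.
move=> stk hpX uhp php.
have /andP[/split_first[qa [y [qb [eQ yh _]]]] _] := dom _ (hpX _ (mem_head _ _)).
have /andP[_ /split_first[sa [y' [sb [eS hy _]]]]] := dom _ (hpX _ (mem_last _ _)).
pose p := (s ++ rcons qa y) ++ (h1 :: ht) ++ y' :: sb ++ rcons l u.
have pe : perm_eq (p ++ qb ++ sa) (X ++ h1 :: ht).
  by apply/seq.permP => b; rewrite /p /X eQ eS -!cats1; count_simpl; clear; lia.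
have upL : uniq (p ++ qb ++ sa).
  rewrite (perm_uniq pe) cat_uniq uX uhp andbT; apply/hasPn => x; exact: hpX.
have -> : m = size p + size (qb ++ sa).
  by rewrite -size_cat (perm_size pe) size_cat stk tX.
move: upL; rewrite cat_uniq => /and3P[up /hasPn npL _].
have e0 : exists w, s ++ rcons qa y = v :: w.
  by case: (s) s0 hds => //= x s' _ ->; exists (s' ++ rcons qa y).
have [w ew] := e0.
apply: (gap_insert_all H) => //.
- rewrite /p ew; apply: sorted_link.
  + move: psQ; rewrite eQ -cat_rcons catA ew /= cat_path; by case/andP.
  + have -> : last v w = y by have := last_cons v v w; rewrite -ew last_cat last_rcons.
    by move: php => /= php; rewrite yh rcons_path php hy.
  + move: pSl; rewrite eS -catA /=; case: (sa) => [|z sa'] //=.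
    by rewrite cat_path /= => /and3P[].
- by rewrite /p ew.
- by rewrite /p ew.
- by rewrite /p !last_cat /= last_cat last_rcons.
- apply: subseq_uniq uK; apply: map_subseq; apply: cat_subseq.
    by rewrite eQ -cat_rcons suffix_subseq.
  by rewrite eS prefix_subseq.
apply/allP => f fL; rewrite npL //= /p -catA -[X in has_gap e f X]cat0s.
apply: has_gap_infix; apply: gs; move: fL; rewrite !mem_cat eQ eS => /orP[fq|fs].
  by case: (qa) => [|z qa'] /=; rewrite ?mem_cat ?inE fq ?orbT.
apply/orP; right; case: (sa) fs => //= z sa'; rewrite belast_cat /= lastI => fs.
by rewrite -cat_rcons mem_cat fs.
Qed.

Lemma nonsingleton_paths v u m : v != u -> 4 <= m -> m <= #|V| -> path_of_length e v u m.
Proof.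
move=> vu m4 mV; have [mr|rm] := leqP (2 * (m - 4)) r; last exact: long_paths.
by apply: (short_paths H vu m4); rewrite mr orbT.
Qed.
End Long.

(** * Arc-pancyclicity *)

Lemma partite_regular_mpt (c alpha r : nat) (V : finType) (P : {set {set V}}) (e : rel V) :
  93 <= c -> multipartite_tournament c P e ->
  (forall A : {set V}, A \in P -> #|A| = alpha) -> regular_digraph r e ->
  regular_mpt (pblock P) e alpha r.
Proof.
move=> hc [pP cP hsame hadj] hP hr.
have cov x : x \in cover P by rewrite (cover_partition pP) inE.
have tP : trivIset P by case/and3P: pP.
split=> // [x y /eqP/hadj //|x|x|x|]; last 1 first.
- by rewrite -cardsT (card_uniform_partition hP pP) cP leq_mul2r hc orbT.
- rewrite -(hP _ (pblock_mem (cov x))); apply: eq_card => y.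
  by rewrite inE eq_sym eq_pblock.
- by have [] := hr x.
- by have [] := hr x.
Qed.

Theorem theorem1p1 (c alpha r : nat) (V : finType) (P : {set {set V}})
    (e : rel V) (hc : 93 <= c) (halpha : 1 <= alpha)
    (hT : multipartite_tournament c P e)
    (hP : forall A : {set V}, A \in P -> #|A| = alpha)
    (hr : regular_digraph r e) :
  arc_pancyclic 4 e.
Proof.
move=> u v euv l /andP[l4 lV].
have H := partite_regular_mpt hc hT hP hr.
have vu : v != u by rewrite eq_sym (mpt_arc_neq H euv).
have [s [ps ls us ss]] : path_of_length e v u l.
  have [a2|a1] := leqP 2 alpha; first exact: (nonsingleton_paths H a2).
  have a_1 : alpha = 1 by apply/eqP; rewrite eqn_leq halpha -ltnS a1.
  by rewrite a_1 in H; apply: (singleton_paths H) => //; rewrite l4.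
exists (v :: s); split=> //.
- by rewrite /ucycle us /= rcons_path ps ls euv.
- by rewrite -ls mem_last.
by rewrite next_nth -{1}ls mem_last nth_default // -ls index_last.
Qed.
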